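(* Let $f=f(x,\xi,t)$, with $x,\xi\in\mathbb{R}^n$ and $t\in[0,\infty)$, be a non-negative solution of $$\partial_t f(x,\xi,t)+\xi\cdot\nabla_x f(x,\xi,t)=I(f,x,\xi,t),\qquad f(x,\xi,0)=f_0(x,\xi),$$ where $I$ is a mesoscopic interaction. Assume that the total mass $\mathbf{M}=\int_{\mathbb{R}^n}\int_{\mathbb{R}^n} f(x,\xi,0)\,dx\,d\xi$ and the total energy $\mathbf{E}=\int_{\mathbb{R}^n}\int_{\mathbb{R}^n} f(x,\xi,0)|\xi|^2\,dx\,d\xi$ are finite. Then there exists a constant $W=W(\mathbf{M},\mathbf{E})$, depending only on the total mass and energy, such that for every $R>0$ $$\frac{1}{R}\int_{0}^{\infty}\int_{\mathbb{R}^{n}}\int_{\mathbb{R}^{n}}\int_{B(x_0,R)}\int_{\mathbb{R}^{n}} f(x,\xi,t)\,f(x_0,\xi_0,t)\,|\xi-\xi_0|^2\,d\xi\,dx\,d\xi_0\,dx_0\,dt< W(\mathbf{M},\mathbf{E}).$$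
   Context: The dimension $n$ is fixed, and $B(x_0,R)\subset\mathbb{R}^n$ is the ball of radius $R$ centered at $x_0$. An interaction $I(f,x,\xi,t)$ is called mesoscopic if for all $x$ and $t$ $$\int_{\mathbb{R}^n} I(f,x,\xi,t)\,d\xi=0,\qquad \int_{\mathbb{R}^n} I(f,x,\xi,t)\,|\xi|^2\,d\xi=0,\qquad \int_{\mathbb{R}^n} I(f,x,\xi,t)\,\xi\,d\xi=0.$$ The evolution equation is equivalently interpreted as a system of ordinary differential equations along characteristics: $\frac{d}{dt}f(x+t\xi,\xi,t)=I(f,x+t\xi,\xi,t)$ with $f(x,\xi,0)=f_0(x,\xi)$. For solutions subject to a mesoscopic interaction, the total mass $\iint f\,dx\,d\xi$, momentum $\iint f\,\xi\,dx\,d\xi$ and energy $\iint f\,|\xi|^2\,dx\,d\xi$ are invariant in time.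
   Formalization: The formal theorem additionally assumes that I(f,x,ξ,t) is measurable and that (1+|ξ|²)|I| is integrable over x, ξ and t in [0,T] for every finite T; without such integrability stationary mesoscopic counterexamples exist. *)

(* Defs.v *)
From HB Require Import structures.
From mathcomp Require Import all_boot all_order all_algebra.
From mathcomp Require Import all_classical all_reals all_analysis.
Set Implicit Arguments.
Unset Strict Implicit.
Unset Printing Implicit Defensive.
Import Order.TTheory GRing.Theory Num.Theory.
Import numFieldNormedType.Exports.
Local Open Scope classical_set_scope.
Local Open Scope ring_scope.

(* 'rV[R]_n carries the product (that is, Borel) sigma-algebra, generated by
   the coordinates; this is how the library treats n.-tuple. *)
Section rV_measurable.
Context {R : realType} {n : nat}.

Definition rV_coord (i : 'I_n) (x : 'rV[R]_n) : R := x ord0 i.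

Let rV_set0 : g_sigma_preimage rV_coord set0.
Proof. exact: sigma_algebra0. Qed.

Let rV_setC A : g_sigma_preimage rV_coord A -> g_sigma_preimage rV_coord (~` A).
Proof. exact: sigma_algebraC. Qed.

Let rV_bigcup (F : (set 'rV[R]_n)^nat) :
  (forall i, g_sigma_preimage rV_coord (F i)) ->
  g_sigma_preimage rV_coord (\bigcup_i (F i)).
Proof. exact: sigma_algebra_bigcup. Qed.

HB.instance Definition _ :=
  @isMeasurable.Build (measure_tuple_display default_measure_display)
    'rV[R]_n (g_sigma_preimage rV_coord) rV_set0 rV_setC rV_bigcup.

Lemma measurable_rV_coord (i : 'I_n) : measurable_fun setT (rV_coord i).
Proof.
move=> _ Y mY; rewrite setTI; apply: sub_sigma_algebra => /=.
rewrite -bigcup_seq/=; exists i => /=; first by rewrite mem_index_enum.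
by exists Y => //; rewrite setTI.
Qed.

Lemma measurable_fun_rVP d (T : measurableType d) (f : T -> 'rV[R]_n) :
  measurable_fun setT f <->
  forall i, measurable_fun setT (rV_coord i \o f).
Proof.
split=> [mf i|mf]; first exact: measurableT_comp (measurable_rV_coord i) mf.
have sub : g_sigma_preimage (fun i => rV_coord i \o f) `<=` measurable.
  apply: smallest_sub; first exact: sigma_algebra_measurable.
  move=> A; rewrite /= -bigcup_seq => -[i _ [B mB <-]].
  exact: mf.
move=> _ A mA; apply: sub; rewrite g_sigma_preimage_comp.
by exists A.
Qed.

End rV_measurable.

Section lebesgue_rV.
Context {R : realType}.

Definition rV_cons {n} (p : R * 'rV[R]_n) : 'rV[R]_n.+1 := row_mx p.1%:M p.2.

Lemma rV_cons0 n (p : R * 'rV[R]_n) : rV_cons p ord0 ord0 = p.1.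
Proof.
rewrite (_ : p.1 = (p.1%:M : 'M[R]_1) ord0 ord0); last by rewrite mxE.
rewrite -(row_mxEl (p.1%:M : 'M[R]_1) p.2 ord0 ord0) (_ : lshift n ord0 = ord0)//.
by apply: ord_inj.
Qed.

Lemma rV_consS n (p : R * 'rV[R]_n) i : rV_cons p ord0 (lift ord0 i) = p.2 ord0 i.
Proof.
rewrite -(row_mxEr (p.1%:M : 'M[R]_1) p.2 ord0 i) (_ : rshift 1 i = lift ord0 i)//.
by apply: ord_inj.
Qed.

Lemma measurable_rV_cons n : measurable_fun setT (@rV_cons n).
Proof.
apply/measurable_fun_rVP => i; case: (unliftP ord0 i) => [j ->|->].
- rewrite (_ : _ \o _ = rV_coord j \o snd).
    exact: measurableT_comp (measurable_rV_coord j) measurable_snd.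
  by apply/funext => p; exact: rV_consS.
- rewrite (_ : _ \o _ = fst); first exact: measurable_fst.
  by apply/funext => p; exact: rV_cons0.
Qed.

Section step.
Context {n : nat} (mu : {sigma_finite_measure set 'rV[R]_n -> \bar R}).

Definition lebesgue_rV_step (A : set 'rV[R]_n.+1) : \bar R :=
  ((@lebesgue_measure R) \x mu)%E (@rV_cons n @^-1` A).

Let step0 : lebesgue_rV_step set0 = 0%E.
Proof. by rewrite /lebesgue_rV_step preimage_set0 measure0. Qed.

Let step_ge0 A : (0 <= lebesgue_rV_step A)%E.
Proof. exact: measure_ge0. Qed.

Let step_sigma_additive : semi_sigma_additive lebesgue_rV_step.
Proof.
move=> F mF tF mUF; rewrite /lebesgue_rV_step preimage_bigcup.
apply: measure_semi_sigma_additive.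
- by move=> k; rewrite -[X in measurable X]setTI; exact: measurable_rV_cons.
- apply/trivIsetP => /= i j _ _ ij; rewrite -preimage_setI.
  by move/trivIsetP : tF => /(_ _ _ _ _ ij) ->//; rewrite preimage_set0.
- rewrite -preimage_bigcup -[X in measurable X]setTI.
  exact: measurable_rV_cons.
Qed.

HB.instance Definition _ := isMeasure.Build _ _ _
  lebesgue_rV_step step0 step_ge0 step_sigma_additive.

Let uncons (x : 'rV[R]_n.+1) : R * 'rV[R]_n :=
  (x ord0 ord0, \row_i x ord0 (lift ord0 i)).

Let rV_consK : cancel (@rV_cons n) uncons.
Proof.
move=> [a v]; rewrite /uncons rV_cons0 /=; congr pair.
by apply/rowP => i; rewrite mxE rV_consS.
Qed.

Let measurable_uncons : measurable_fun setT uncons.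
Proof.
apply: measurable_fun_pair; first exact: (measurable_rV_coord ord0).
apply/measurable_fun_rVP => i; rewrite (_ : _ \o _ = rV_coord (lift ord0 i)).
  exact: measurable_rV_coord.
by apply/funext => x; rewrite /rV_coord /= mxE.
Qed.

Let step_sigma_finite : sigma_finite setT lebesgue_rV_step.
Proof.
have /sigma_finiteP[F [TF ndF Foo]] := sigma_finiteT (@lebesgue_measure R).
have /sigma_finiteP[G [TG ndG Goo]] := sigma_finiteT mu.
exists (fun k => uncons @^-1` (F k `*` G k)).
  apply/esym; rewrite -subTset => x _.
  have [k _ Fk] : (\bigcup_i F i) (uncons x).1 by rewrite -TF.
  have [l _ Gl] : (\bigcup_i G i) (uncons x).2 by rewrite -TG.
  exists (maxn k l) => //; split.
  - by move: (uncons x).1 Fk; exact/subsetPset/ndF/leq_maxl.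
  - by move: (uncons x).2 Gl; exact/subsetPset/ndG/leq_maxr.
move=> k; have [mFk Fkoo] := Foo k; have [mGk Gkoo] := Goo k; split.
  by rewrite -[X in measurable X]setTI; apply: measurable_uncons => //;
    exact: measurableX.
rewrite /lebesgue_rV_step -comp_preimage (_ : uncons \o _ = id).
  by rewrite preimage_id product_measure1E// lte_mul_pinfty// ge0_fin_numE.
by apply/funext => p; exact: rV_consK.
Qed.

HB.instance Definition _ := Measure_isSigmaFinite.Build _ _ _
  lebesgue_rV_step step_sigma_finite.

End step.

Fixpoint lebesgue_rV (n : nat) : {sigma_finite_measure set 'rV[R]_n -> \bar R} :=
  match n with
  | 0 => \d_(0 : 'rV[R]_0)
  | k.+1 => lebesgue_rV_step (lebesgue_rV k)
  end.

Lemma lebesgue_rV_box n (A : 'I_n -> set R) : (forall i, measurable (A i)) ->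
  lebesgue_rV n [set x | forall i, A i (x ord0 i)] =
  (\prod_(i < n) lebesgue_measure (A i))%E.
Proof.
elim: n A => [|n IH] A mA.
  rewrite big_ord0 /= diracE mem_set//.
  by case.
rewrite big_ord_recl -IH//= /lebesgue_rV_step -product_measure1E//.
- congr (_ _); apply/seteqP; split=> -[a v] /=.
  + move=> h; split=> [|i]; first by have := h ord0; rewrite rV_cons0.
    by have := h (lift ord0 i); rewrite rV_consS.
  + move=> [h0 h] i; case: (unliftP ord0 i) => [j ->|->].
      by rewrite rV_consS; exact: h.
    by rewrite rV_cons0.
- exact: mA.
- rewrite (_ : (fun _ => _) =
      \bigcap_(i in [set: 'I_n]) (rV_coord i @^-1` A (lift ord0 i))).
    apply: fin_bigcap_measurable => // i _; rewrite -[X in measurable X]setTI.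
    exact: (measurable_rV_coord i).
  by apply/seteqP; split=> v h i; [move=> _; exact: h|exact: (h i)].
Qed.

End lebesgue_rV.

Section kinetic.
Context {R : realType} {n : nat}.
Notation V := 'rV[R]_n.
Notation leb := (lebesgue_rV (R := R) n).
Implicit Types (f : V -> V -> R -> R)
  (I : (V -> V -> R -> R) -> V -> V -> R -> R).

(* The library's norm on matrices is the sup norm, hence these two. *)
Definition sqnorm (x : V) : R := \sum_(i < n) x ord0 i ^+ 2.

Definition eball (x0 : V) (r : R) : set V :=
  [set x | Num.sqrt (sqnorm (x - x0)) < r].

Definition phase_measurable (g : V -> V -> R -> R) : Prop :=
  measurable_fun [set p : V * V * R | 0 <= p.2] (fun p => g p.1.1 p.1.2 p.2).

(* The transport equation as a system of ordinary differential equations along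
   the characteristics t |-> x + t xi. Functions of time are total on R but only
   their values on [0, +oo[ matter; at t = 0 the equation amounts to the initial
   condition and continuity from the right. *)
Definition transport_solution I f (f0 : V -> V -> R) : Prop :=
  [/\ phase_measurable f,
      forall x xi, f x xi 0 = f0 x xi,
      forall x xi, {within `[0, +oo[, continuous (fun t => f (x + t *: xi) xi t)} &
      forall (x xi : V) (t : R), 0 < t ->
        is_derive t 1 (fun s => f (x + s *: xi) xi s) (I f (x + t *: xi) xi t)].

(* The integrals are extended-real valued: one whose positive and negative parts
   are both infinite equals -oo, so each equation includes integrability. *)
Definition mesoscopic I f : Prop :=
  forall (x : V) (t : R), 0 <= t ->
  [/\ (\int[leb]_xi (I f x xi t)%:E = 0)%E,
      (\int[leb]_xi (I f x xi t * sqnorm xi)%:E = 0)%E &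
      forall i : 'I_n, (\int[leb]_xi (I f x xi t * xi ord0 i)%:E = 0)%E].

(* Integrability of the moments of I in (x, xi) and locally in time. It is what
   turns the pointwise (in x) cancellations of a mesoscopic interaction into the
   conservation of total mass, momentum and energy. *)
Definition integrable_interaction I f : Prop :=
  phase_measurable (I f) /\
  forall T : R, 0 < T ->
    (\int[lebesgue_measure]_(t in `[0%R, T]) \int[leb]_x \int[leb]_xi
       (`|I f x xi t| * (1 + sqnorm xi))%:E < +oo)%E.

Definition total_mass (g : V -> V -> R) : \bar R :=
  (\int[leb]_xi \int[leb]_x (g x xi)%:E)%E.

Definition total_energy (g : V -> V -> R) : \bar R :=
  (\int[leb]_xi \int[leb]_x (g x xi * sqnorm xi)%:E)%E.

End kinetic.

(* Main.v *)
(** Let phi(z) = sqrt(r^2 + |z|^2) and consider the action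
      A(t) = int f(x, xi, t) f(x0, xi0, t) (xi - xi0) . grad phi(x - x0)
    over all pairs of phase points. Since |grad phi| <= 1, conservation of mass
    and energy gives |A| <= (M + E)^2. A mesoscopic I is orthogonal, at each
    fixed x, to all affine functions of xi, so it does not contribute to A', which
    is the integral of f f0 v^T (Hess phi) v with v = xi - xi0. As phi is convex
    and Hess phi >= 1/(4r) on the ball of radius r, integrating A' in time bounds
    the left-hand side by 8 (M + E)^2.

    Along characteristics f is only pointwise differentiable with an integrable
    derivative, so time integration uses the fundamental theorem of calculus for
    everywhere differentiable functions, proved with the Vitali-Caratheodory
    theorem. *)

(* The work is done along characteristics: a phase point keeps its velocity, [F p t] solves an
   ordinary differential equation in [t], and the displacement between two such points is affine in
   time, so no spatial derivative of [f] ever occurs. The moments of [I], however, vanish at a fixed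
   position, which moves along characteristics; the measure-preserving shear
   [(x, xi) -> (x + t xi, xi)] translates between the two pictures. The obstacle is integrability.
   The moments of [I] are integrable only jointly in space and time, so their phase-space integrals
   are finite for almost every [t] only, and the derivative of the action is computed only for such
   [t]. The weight [1 + |xi|^2] organises all bounds: its integral against [f] is [M + E], its
   integral against [|I|] is locally integrable in time, and [|xi - xi0|] is at most the product of
   the two weights, so that pair integrals factor. The constant 8 is 4, from the Hessian on the
   ball, times 2, from the two endpoints of the action. *)
From HB Require Import structures.
Require Import Defs.
From mathcomp Require Import all_boot all_order all_algebra.
From mathcomp Require Import all_classical all_reals all_analysis.
From mathcomp Require Import measurable_realfun ring lra.
Import Order.TTheory GRing.Theory Num.Theory.
Import numFieldNormedType.Exports.
Local Open Scope classical_set_scope.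
Local Open Scope ring_scope.

(** * Everywhere differentiable functions with integrable derivative *)

Section ftc_everywhere_differentiable.
Context {R : realType}.
Local Notation lam := (@lebesgue_measure R).

(* Vitali-Caratheodory: the k of size about j delta is dominated on an open set
   V_j barely larger than the level set E_j; u sums the (j + 1) delta 1_(V_j). *)
Lemma lsc_majorant (k : R -> R) (D : set R) (eta : R) :
  measurable D -> (lam D < +oo)%E -> measurable_fun setT k ->
  (forall x, 0 <= k x) -> 0 < eta ->
  exists u : R -> \bar R, [/\ measurable_fun setT u,
    forall x, (0 <= u x)%E,
    (\int[lam]_(x in D) u x <= \int[lam]_(x in D) (k x)%:E + eta%:E)%E &
    forall x, D x -> exists c, k x < c /\ \forall y \near x, (c%:E <= u y)%E].
Proof.
move=> mD Doo mk k0 eta0.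
have lamD : lam D = (fine (lam D))%:E by rewrite fineK// ge0_fin_numE.
have lamD0 : 0 <= fine (lam D) by rewrite fine_ge0.
(* Rounding [k] up to the next multiple of [delta] costs at most [delta * lam D], and enlarging the
   [E j] to the [V j] costs [delta] in total; together [delta * (lam D + 1) = eta]. *)
pose delta := eta / (fine (lam D) + 1).
have d0 : 0 < delta by rewrite divr_gt0// ltr_wpDl.
pose E j := D `&` k @^-1` `[j%:R * delta, j.+1%:R * delta[.
have mE j : measurable (E j).
  apply: measurableI => //; rewrite -[X in measurable X]setTI; exact: mk.
have Ej x : D x -> exists j, E j x /\ forall i, i != j -> ~ E i x.
  move=> Dx; have kd0 : 0 <= k x / delta by rewrite divr_ge0// ltW.
  exists (Num.truncn (k x / delta)).
  have EP i : E i x <-> i%:R <= k x / delta < i.+1%:R.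
    by rewrite ler_pdivlMr// ltr_pdivrMr// /E /= in_itv/=; split => // -[].
  split; first exact/EP/truncn_itv.
  by move=> i /eqP ij /EP /truncn_def /esym.
have Eoo j : (lam (E j) < +oo)%E.
  by apply: le_lt_trans Doo; apply: le_measure; rewrite ?inE//; [exact: mE|move=> x []].
(* Chosen so that [c j * e j = delta / 2 ^ (j + 1)]: the excess measures of the [V j] then
   contribute a geometric series of sum [delta]. *)
pose e j : R := 1 / (j.+1%:R * (2 ^ j.+1)%:R).
have e0 j : 0 < e j by rewrite divr_gt0// mulr_gt0// ltr0n// expn_gt0.
have /choice[V HV] j := @lebesgue_regularity_outer R _ _ (mE j) (Eoo j) (e0 j).
have mV j : measurable (V j) by apply: open_measurable; case: (HV j).
pose c j : R := j.+1%:R * delta.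
have c0 j : 0 < c j by rewrite mulr_gt0.
pose v j x : \bar R := ((c j)%:E * (\1_(V j) x)%:E)%E.
have v0 j x : (0 <= v j x)%E by rewrite mule_ge0// lee_fin// ltW.
have mv j A : measurable_fun A (v j).
  by apply: measurable_funeM; exact/measurable_EFinP/measurable_indic.
exists (fun x => \sum_(j <oo) v j x)%E; split.
- by apply: ge0_emeasurable_sum => //.
- by move=> x; apply: nneseries_ge0.
- rewrite integral_nneseries//; last by move=> j; exact: mv.
  pose w j x : \bar R := ((c j)%:E * (\1_(E j) x)%:E)%E.
  have w0 j x : (0 <= w j x)%E by rewrite mule_ge0// lee_fin// ltW.
  have mw j A : measurable_fun A (w j).
    by apply: measurable_funeM; exact/measurable_EFinP/measurable_indic.
  have vw j : (\int[lam]_(x in D) v j x <=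
      \int[lam]_(x in D) w j x + (delta / (2 ^ j.+1)%:R)%:E)%E.
    have mVj := mV j; have mEj := mE j.
    rewrite /v /w !ge0_integralZl_EFin ?(ltW (c0 j))//; last 2 first.
      by apply/measurable_EFinP; exact: measurable_indic.
      by apply/measurable_EFinP; exact: measurable_indic.
    rewrite !integral_indic//.
    have [oV EV VE] := HV j.
    have -> : (delta / (2 ^ j.+1)%:R)%:E = ((c j)%:E * (e j)%:E)%E.
      rewrite -EFinM /c /e; congr EFin.
      by rewrite mul1r invfM mulrACA divff ?mul1r// pnatr_eq0.
    rewrite -ge0_muleDr//; last by rewrite lee_fin ltW.
    apply: lee_pmul => //; first by rewrite lee_fin ltW.
    have -> : E j `&` D = E j by apply/setIidPl => x [].
    apply: (@le_trans _ _ (lam (V j))).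
      apply: le_measure; rewrite ?inE; last exact: subIsetl.
      - exact: measurableI (mV j) mD.
      - exact: mV.
    rewrite -(setDUK EV) measureU;
      [|exact: mE|exact: measurableD (mV j) (mE j)|]; last first.
      by apply/seteqP; split => x // [? []].
    by rewrite leeD2l// ltW.
  apply: le_trans (lee_nneseries _ (fun j _ => vw j)) _.
    by move=> i _ _; apply: integral_ge0.
  apply: le_trans (epsilon_trick _ _ (ltW d0)) _.
    by move=> i; apply: integral_ge0.
  rewrite -integral_nneseries//; last by move=> j; exact: mw.
  have wk : (\int[lam]_(x in D) (\sum_(j <oo) w j x) <=
      \int[lam]_(x in D) ((k x)%:E + delta%:E))%E.
    apply: ge0_le_integral => //.
    + by move=> x _; exact: nneseries_ge0.
    + by apply: (@ge0_emeasurable_sum _ _ _ D w) => //.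
    + by apply/measurable_EFinP/measurable_funD => //; exact: measurable_funTS.
    + move=> x Dx; have [j [Ejx nE]] := Ej x Dx.
      rewrite (nneseriesD1 (n := j))//.
      rewrite eseries0 ?adde0; last first.
        by move=> i _ /= ij; rewrite /w indicE memNset ?mule0//; exact: nE.
      rewrite /w indicE mem_set// mule1 -EFinD lee_fin /c -natr1 mulrDl mul1r.
      by rewrite lerD2r; case: Ejx; rewrite /= in_itv/= => _ /andP[].
  apply: le_trans (leeD wk (lexx _)) _.
  rewrite ge0_integralD//; last 3 first.
  + by move=> x _; rewrite lee_fin.
  + exact/measurable_EFinP/measurable_funTS.
  + by move=> x _; rewrite lee_fin ltW.
  have -> : (\int[lam]_(_ in D) delta%:E)%E = (delta * fine (lam D))%:E.
    by rewrite [RHS]EFinM fineK ?ge0_fin_numE//; exact: integral_cst.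
  rewrite -addeA leeD2l// -EFinD lee_fin.
  by rewrite /delta -[X in _ + X]mulr1 -mulrDr divfK// lt0r_neq0// ltr_wpDl.
(* The level sets [E j] are half-open on the right, which makes [k x < c j] strict; on the
   neighbourhood [V j] of [x] the sum is at least its [j]-th term [c j]. *)
- move=> x Dx; have [j [Ejx _]] := Ej x Dx.
  exists (c j); split; first by case: Ejx; rewrite /= in_itv/= => _ /andP[].
  have [oV EV _] := HV j.
  have : nbhs x (V j) by apply: open_nbhs_nbhs; split => //; exact: EV.
  apply: filterS => y Vy.
  rewrite (nneseriesD1 (n := j))//.
  rewrite {1}/v indicE mem_set// mule1 leeDl//.
  by apply: nneseries_ge0.
Qed.

Lemma is_derive_right_increment {G : R -> R} {s l c : R} :
  is_derive s 1 G l -> l < c ->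
  exists2 e, 0 < e & forall t, 0 < t < e -> G (s + t) - G s < c * t.
Proof.
move=> [dG <-] lc.
have : \forall t \near 0^', t^-1 *: ((G \o shift s) (t *: (1 : R)) - G s) < c.
  by apply: cvgr_lt lc; exact: dG.
rewrite near_withinE => /nbhs_ballP[e /= e0 He].
exists e => // t /andP[t0 te].
have /He : ball (0 : R) e t by rewrite /ball/= sub0r normrN gtr0_norm.
move=> /(_ (lt0r_neq0 t0)).
rewrite /= [_%:A]mulr1 -[_ *: _]/(_ * _) addrC (mulrC _^-1) addrC.
by rewrite ltr_pdivrMr// (addrC t).
Qed.

(** Continuous induction against the majorant [u] of [lsc_majorant]: at each point the slope of [G]
    is strictly below a constant that bounds [u] from below nearby, so the integral of [u] outgrows
    [G] a little further to the right. The loss [eta] then tends to 0. *)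
Lemma increment_le_integral (G h k : R -> R) (a b : R) : a < b ->
  {within `[a, b], continuous G} ->
  (forall t, a < t < b -> is_derive t 1 G (h t)) ->
  measurable_fun setT k -> (forall t, 0 <= k t) ->
  (forall t, a < t < b -> h t <= k t) ->
  ((G b - G a)%:E <= \int[lam]_(t in `[a, b]) (k t)%:E)%E.
Proof.
move=> ab cG dG mk k0 hk.
have [dmid Ga Gb] := (continuous_within_itvP _ ab).1 cG.
apply/lee_addgt0Pr => eta eta0.
have lamab : (lam `[a, b] < +oo)%E.
  by rewrite lebesgue_measure_itv/= lte_fin ab -EFinD ltry.
have [u [mu u0 iu hu]] := lsc_majorant _ _ _ (measurable_itv `[a, b]) lamab mk k0 eta0.
apply: le_trans iu.
(* The derivative is known only inside []a, b[], so the induction starts at [a' > a]; continuity of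
   [G] at [a] lets [a'] tend to [a] at the end. *)
have claim a' : a < a' < b ->
    ((G b - G a')%:E <= \int[lam]_(t in `[a, b]) u t)%E.
  move=> /andP[aa' a'b].
  pose U y := (\int[lam]_(t in `]a', y]) u t)%E.
  have U_mono x y : x <= y -> (U x <= U y)%E.
    move=> xy; apply: ge0_subset_integral => //; first exact: measurable_funTS.
    by apply: subset_itvl; rewrite bnd_simp.
  pose S := [set y | a' <= y <= b /\ ((G y - G a')%:E <= U y)%E].
  have Sa' : S a'.
    split; first by rewrite lexx ltW.
    by rewrite subrr; exact: integral_ge0.
  have hS : has_sup S by split; [exists a'|exists b => y [/andP[]]].
  pose s := sup S.
  have a's : a' <= s by apply: ub_le_sup => //; case: hS.
  have sb : s <= b by apply: ge_sup; [exists a'|move=> y [/andP[]]].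
  (* The supremum belongs to [S]: points of [S] approach [s] from the left, where [G] is continuous
     and [U] is nondecreasing. *)
  have Ss : S s.
    split; first by rewrite a's.
    apply/lee_addgt0Pr => e e0.
    have : \forall y \near within `[a, b] (nbhs s), `|G s - G y| < e.
      have /subspace_continuousP/(_ s) := cG.
      have sab : `[a, b]%classic s.
        by rewrite /= in_itv/= sb (le_trans (ltW aa')).
      by move=> /(_ sab) /cvgrPdist_lt; exact.
    rewrite near_withinE => /nbhs_ballP[d /= d0 Hd].
    have [y [/andP[a'y yb] GU] sdy] := sup_adherent d0 hS.
    have ys : y <= s by apply: ub_le_sup; [case: hS|split=> //; rewrite a'y].
    apply: le_trans (leeD (le_trans GU (U_mono _ _ ys)) (lexx _)).
    rewrite -EFinD lee_fin.
    have : ball s d y by rewrite /ball/= ger0_norm ?subr_ge0// ltrBlDr -ltrBlDl.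
    move=> /Hd; rewrite /= in_itv/= yb (le_trans (ltW aa') a'y) => /(_ isT).
    by rewrite ltr_norml => /andP[_]; lra.
  suff <- : s = b.
    case: Ss => _ /le_trans; apply; apply: ge0_subset_integral => //.
      exact: measurable_funTS.
    by apply: subset_itv; rewrite bnd_simp// ltW.
  (* If [s < b], take [c] with [h s <= k s < c] and [u >= c] near [s]. Over a short step [t], [G]
     gains less than [c * t] and the integral of [u] at least [c * t], so [s + t] lies in [S],
     against the choice of [s]. *)
  apply/eqP; rewrite eq_le sb/= leNgt; apply/negP => sltb.
  have asb : a < s < b by rewrite sltb (lt_le_trans aa').
  have [|c [kc cu]] := hu s.
    by rewrite /= in_itv/= !ltW//; case/andP: asb.
  have [e1 e10 He1] := is_derive_right_increment (dG s asb) (le_lt_trans (hk s asb) kc).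
  move: cu => /nbhs_ballP[e2 /= e20 He2].
  pose t := Num.min (Num.min e1 e2) (b - s) / 2.
  have m0 : 0 < Num.min (Num.min e1 e2) (b - s).
    by rewrite !lt_min e10 e20 subr_gt0.
  have t0 : 0 < t by rewrite divr_gt0.
  have : t < Num.min (Num.min e1 e2) (b - s) by rewrite ltr_pdivrMr// ltr_pMr// ltr1n.
  rewrite !lt_min => /andP[/andP[te1 te2] tbs].
  suff : s + t <= s by rewrite leNgt ltrDl t0.
  apply: ub_le_sup; first by case: hS.
  split.
    by rewrite (le_trans a's) ?lerDl ?ltW//= -ltrBrDl.
  have -> : G (s + t) - G a' = (G s - G a') + (G (s + t) - G s) by ring.
  have -> : U (s + t) = (U s + \int[lam]_(x in `]s, (s + t)%R]) u x)%E.
    rewrite /U -ge0_integral_setU//=.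
    - by congr integral; rewrite -itv_bndbnd_setU// bnd_simp// lerDl ltW.
    - exact: measurable_funTS.
    - apply/disj_setPRL => x; rewrite /= !in_itv/= => /andP[sx _] /andP[_].
      by rewrite leNgt sx.
  rewrite EFinD leeD//; first by case: Ss.
  apply: (@le_trans _ _ (c * t)%:E).
    by rewrite lee_fin ltW// He1// t0.
  rewrite -[leLHS]/(c * t)%:E.
  apply: (@le_trans _ _ (\int[lam]_(x in `]s, (s + t)%R]) c%:E)%E).
    rewrite integral_cst//= lebesgue_measure_itv/= lte_fin ltrDl t0 -EFinD.
    by rewrite addrAC subrr add0r.
  apply: ge0_le_integral => //.
  + by move=> x _; rewrite lee_fin (le_trans (k0 s))// ltW.
  + exact: measurable_funTS.
  + move=> x; rewrite /= in_itv/= => /andP[sx xt]; apply: He2.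
    by rewrite /ball/= ltr0_norm ?subr_lt0// opprB; lra.
apply/lee_addgt0Pr => e e0.
near a^'+ => x.
apply: (@le_trans _ _ ((G b - G x)%:E + e%:E)%E).
  rewrite -EFinD lee_fin.
  have : `|G a - G x| < e by near: x; move/cvgrPdist_lt : Ga; exact.
  by rewrite ltr_norml => /andP[? _]; lra.
rewrite leeD2r// claim//; apply/andP.
by split; near: x; [exact: nbhs_right_gt|exact: nbhs_right_lt].
Unshelve. all: by end_near.
Qed.

(** To reach the nonnegative case, truncate [h] below at [-n] and add [n * t] to [G]; the added
    terms cancel from both sides. The truncation is removed by dominated convergence, with [|h|] as
    dominating function. *)
Let ftc_integrable_derivative_le (G h : R -> R) (a b : R) : a < b ->
  {within `[a, b], continuous G} ->
  (forall t, a < t < b -> is_derive t 1 G (h t)) ->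
  measurable_fun setT h -> lam.-integrable `[a, b] (EFin \o h) ->
  ((G b - G a)%:E <= \int[lam]_(t in `[a, b]) (h t)%:E)%E.
Proof.
move=> ab cG dG mh ih.
pose hn n t := Num.max (h t) (- n%:R).
have mhn n : measurable_fun setT (hn n) by exact: measurable_maxr.
have hnh n t : `|hn n t| <= `|h t|.
  have n0 : 0 <= n%:R :> R by [].
  rewrite /hn; case: (leP (h t) (- n%:R)) => // hltn.
  by rewrite !ler0_norm; lra.
have hcvg : (\int[lam]_(t in `[a, b]) (hn n t)%:E @[n --> \oo] -->
    \int[lam]_(t in `[a, b]) (h t)%:E)%E.
  apply: (@dominated_cvg _ _ _ lam _ _ (fun n t => (hn n t)%:E) _
    (fun t => `|h t|%:E)) => //.
  - by move=> n; apply/measurable_EFinP; exact: measurable_funTS (mhn n).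
  - move=> t _; apply: cvg_near_cst; near=> n; congr EFin.
    rewrite /hn; apply/max_idPl; rewrite lerNl.
    by near: n; exact: nbhs_infty_ger.
  - exact: (integrable_abse ih).
  - by move=> n t _; rewrite abse_EFin lee_fin.
have ihn n : lam.-integrable `[a, b] (fun t => (hn n t)%:E).
  apply: (le_integrable _ _ _ ih) => //.
    by apply/measurable_EFinP; exact: measurable_funTS (mhn n).
  by move=> t _; rewrite /= lee_fin.
rewrite -(cvg_lim _ hcvg)//; apply: lime_ge.
  by apply/cvg_ex; eexists; exact: hcvg.
apply: nearW => n.
have : ((G b + n%:R * b - (G a + n%:R * a))%:E <=
    \int[lam]_(t in `[a, b]) (hn n t + n%:R)%:E)%E.
  apply: (@increment_le_integral (fun t => G t + n%:R * t)
      (fun t => h t + n%:R)) => //.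
  - move=> x; apply: cvgD; first exact: cG.
    by apply: continuous_subspaceT => y; exact: mulrl_continuous.
  - move=> t abt; have dGt := dG t abt.
    have dnt : is_derive t 1 (fun t => n%:R * t) (n%:R : R).
      rewrite -[X in is_derive _ _ _ X]mulr1.
      exact: (@is_deriveZ _ _ _ id).
    exact: is_deriveD.
  - exact: measurable_funD.
  - by move=> t; rewrite -lerBlDr sub0r le_max lexx orbT.
  - by move=> t _; rewrite lerD2r le_max lexx.
have inn : lam.-integrable `[a, b] (fun=> n%:R%:E).
  apply/integrableP; split; first exact: measurable_cst.
  by rewrite integral_cst//= lebesgue_measure_itv/= lte_fin ab -EFinD ltry.
under eq_integral do rewrite EFinD.
rewrite integralD//.
rewrite integral_cst//= lebesgue_measure_itv/= lte_fin ab -EFinD -EFinM.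
rewrite -leeBlDr// -EFinB; congr (_%:E <= _)%E; ring.
Unshelve. all: by end_near.
Qed.

(** The reverse inequality is the previous one for [- G]. Differentiability at every interior point
    cannot be relaxed to almost every one: the Cantor function would be a counterexample. *)
Theorem ftc_integrable_derivative (G h : R -> R) (a b : R) : a < b ->
  {within `[a, b], continuous G} ->
  (forall t, a < t < b -> is_derive t 1 G (h t)) ->
  measurable_fun setT h -> lam.-integrable `[a, b] (EFin \o h) ->
  ((G b)%:E = (G a)%:E + \int[lam]_(t in `[a, b]) (h t)%:E)%E.
Proof.
move=> ab cG dG mh ih.
have le_int := @ftc_integrable_derivative_le G h a b ab cG dG mh ih.
have : ((- G b + G a)%:E <= \int[lam]_(t in `[a, b]) (- h t)%:E)%E.
  rewrite -[X in _ + X]opprK.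
  apply: (@ftc_integrable_derivative_le (fun t => - G t) (fun t => - h t)) => //.
  - by move=> x; apply: cvgN; exact: cG.
  - by move=> t abt; have dGt := dG t abt; exact: is_deriveN.
  - exact: measurableT_comp.
  - exact: (integrableN ih).
have ifin : (\int[lam]_(t in `[a, b]) (h t)%:E)%E \is a fin_num.
  exact: integrable_fin_num.
under [X in (_ <= X)%E]eq_integral do rewrite EFinN.
rewrite integralN/=; last first.
  by apply: fin_num_adde_defr; exact: integrable_pos_fin_num.
move: le_int ifin; rewrite /comp.
case: (\int[lam]_(t in `[a, b]) _)%E => // r; rewrite -EFinN !lee_fin => ge _ le.
by rewrite -EFinD; congr EFin; lra.
Qed.

End ftc_everywhere_differentiable.

(** * Integrating a time-dependent family over a parameter space *)

Section integral_of_differentiable_family.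
Context d (X : measurableType d) (R : realType).
Variable mu : {sigma_finite_measure set X -> \bar R}.
Local Notation lam := (@lebesgue_measure R).

(** The fundamental theorem applies for almost every [x], those with [k (x, t)] integrable in [t];
    Fubini then exchanges the two integrals. The function [g] leaves room for a space integral of
    [k] that is identified only for almost every [t]. *)
Lemma integral_derivative_in_time (u : X -> R -> R) (k : X * R -> R)
    (g : R -> \bar R) (T : R) :
  0 < T ->
  (forall x, {within `[0, T], continuous (u x)}) ->
  (forall x t, 0 < t < T -> is_derive t 1 (u x) (k (x, t))) ->
  measurable_fun setT k -> measurable_fun setT (u ^~ T) ->
  mu.-integrable setT (fun x => (u x 0)%:E) ->
  (\int[lam]_(t in `[0%R, T]) \int[mu]_x `|k (x, t)|%:E < +oo)%E ->
  measurable_fun `[0, T] g ->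
  {ae lam, forall t, `[0, T]%classic t -> (\int[mu]_x (k (x, t))%:E = g t)%E} ->
  (\int[mu]_x (u x T)%:E = \int[mu]_x (u x 0)%:E +
    \int[lam]_(t in `[0%R, T]) g t)%E.
Proof.
move=> T0 cu du mk muT iu0 ik mg kg.
(* Cutting [k] off outside [[0, T]] makes it integrable on the whole product, where Fubini
   applies. *)
pose kT z := k z * \1_(`[0, T]%classic : set R) z.2.
have mkT : measurable_fun setT kT.
  apply: measurable_funM => //.
  by apply: measurableT_comp => //; exact: measurable_indic.
have kT_in x t : `[0, T]%classic t -> kT (x, t) = k (x, t).
  by move=> tT; rewrite /kT /= indicE mem_set// mulr1.
have kT_out x t : ~ `[0, T]%classic t -> kT (x, t) = 0.
  by move=> tT; rewrite /kT /= indicE memNset// mulr0.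
have ikT : (mu \x lam)%E.-integrable setT (EFin \o kT).
  apply/integrable21ltyP; first exact/measurable_EFinP.
  apply: le_lt_trans ik; rewrite [leRHS]integral_mkcond.
  rewrite le_eqVlt; apply/orP; left; apply/eqP; apply: eq_integral => t _.
  rewrite patchE; case: ifPn => [/set_mem tT|/negP tT].
    by apply: eq_integral => x _ /=; rewrite kT_in.
  rewrite integral0_eq// => x _ /=; rewrite kT_out ?normr0// => tT'.
  by apply: tT; rewrite inE.
have aeT : {ae mu, forall x, setT x -> (u x T)%:E =
    ((u x 0)%:E + \int[lam]_t (kT (x, t))%:E)%E}.
  have := ae_integrable1 ikT; apply: filterS => x ikTx _.
  have mkx : measurable_fun setT (fun t => k (x, t)) by exact: measurableT_comp.
  have ikx : lam.-integrable `[0, T] (EFin \o (fun t => k (x, t))).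
    apply: (@eq_integrable _ _ _ lam `[0, T]%classic _ (fun t => (kT (x, t))%:E)) => //.
      by move=> t /set_mem tT /=; rewrite kT_in.
    exact: integrableS ikTx.
  rewrite (@ftc_integrable_derivative _ _ _ _ _ T0 (cu x) (du x) mkx ikx).
  congr (_ + _)%E; rewrite integral_mkcond; apply: eq_integral => t _.
  rewrite patchE; case: ifPn => [/set_mem tT|/negP tT]; first by rewrite kT_in.
  by rewrite kT_out// => tT'; apply: tT; rewrite inE.
have iF : mu.-integrable setT (fun x => \int[lam]_t (kT (x, t))%:E)%E.
  exact: integrable_fubini_F ikT.
transitivity (\int[mu]_x ((u x 0)%:E + \int[lam]_t (kT (x, t))%:E))%E.
  apply: ae_eq_integral => //; first exact/measurable_EFinP.
  by apply: emeasurable_funD; [case/integrableP: iu0|case/integrableP: iF].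
rewrite integralD//; congr (_ + _)%E.
transitivity (\int[lam]_t \int[mu]_x (kT (x, t))%:E)%E.
  exact: (Fubini ikT).
have mG : measurable_fun setT (fun t => \int[mu]_x (kT (x, t))%:E)%E.
  exact: measurable_fubini_G ikT.
transitivity (\int[lam]_(t in `[0%R, T]) \int[mu]_x (kT (x, t))%:E)%E.
  rewrite [RHS]integral_mkcond; apply: eq_integral => t _.
  rewrite patchE; case: ifPn => // /negP tT.
  by apply: integral0_eq => x _; rewrite kT_out// => tT'; apply: tT; rewrite inE.
apply: ae_eq_integral => //; first exact: measurable_funTS mG.
apply: (@filterS _ _ (ae_filter_ringOfSetsType lam)) kg => t kg tT.
by rewrite -kg//; apply: eq_integral => x _; rewrite kT_in.
Qed.

End integral_of_differentiable_family.

(** * Product measures and translations *)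

(* The library only makes m1 \x m2 canonically sigma-finite for subprobabilities. *)
Section sigma_finite_product.
Context {d1 d2} {T1 : measurableType d1} {T2 : measurableType d2} {R : realType}.
Variable m1 : {sigma_finite_measure set T1 -> \bar R}.
Variable m2 : {sigma_finite_measure set T2 -> \bar R}.

Definition sigma_finite_prod : set (T1 * T2) -> \bar R := (m1 \x m2)%E.

HB.instance Definition _ := Measure.on sigma_finite_prod.

Let sigma_finite_prodT : sigma_finite setT sigma_finite_prod.
Proof.
have /sigma_finiteP[A [TA ndA Aoo]] := sigma_finiteT m1.
have /sigma_finiteP[B [TB ndB Boo]] := sigma_finiteT m2.
exists (fun k => A k `*` B k).
  apply/esym; rewrite -subTset => -[x y] _.
  have [k _ Ak] : (\bigcup_i A i) x by rewrite -TA.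
  have [l _ Bl] : (\bigcup_i B i) y by rewrite -TB.
  exists (maxn k l) => //; split.
  - by move: x Ak; exact/subsetPset/ndA/leq_maxl.
  - by move: y Bl; exact/subsetPset/ndB/leq_maxr.
move=> k; have [mAk Akoo] := Aoo k; have [mBk Bkoo] := Boo k; split.
  exact: measurableX.
by rewrite /sigma_finite_prod product_measure1E// lte_mul_pinfty// ge0_fin_numE.
Qed.

HB.instance Definition _ := Measure_isSigmaFinite.Build _ _ _
  sigma_finite_prod sigma_finite_prodT.

Local Open Scope ereal_scope.

Lemma tonelli12 (h : T1 * T2 -> \bar R) :
  measurable_fun setT h -> (forall z, 0 <= h z) ->
  \int[sigma_finite_prod]_z h z = \int[m1]_x \int[m2]_y h (x, y).
Proof. by move=> mh h0; exact: fubini_tonelli1. Qed.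

Lemma tonelli21 (h : T1 * T2 -> \bar R) :
  measurable_fun setT h -> (forall z, 0 <= h z) ->
  \int[sigma_finite_prod]_z h z = \int[m2]_y \int[m1]_x h (x, y).
Proof. by move=> mh h0; exact: fubini_tonelli2. Qed.

Lemma fubini12 (h : T1 * T2 -> \bar R) : sigma_finite_prod.-integrable setT h ->
  \int[sigma_finite_prod]_z h z = \int[m1]_x \int[m2]_y h (x, y).
Proof. by move=> ih; rewrite -(integral12_prod_meas1 ih). Qed.

Lemma fubini21 (h : T1 * T2 -> \bar R) : sigma_finite_prod.-integrable setT h ->
  \int[sigma_finite_prod]_z h z = \int[m2]_y \int[m1]_x h (x, y).
Proof. by move=> ih; rewrite -(integral21_prod_meas1 ih). Qed.

Lemma measurable_integral1 (h : T1 * T2 -> \bar R) :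
  measurable_fun setT h -> (forall z, 0 <= h z) ->
  measurable_fun setT (fun y => \int[m1]_x h (x, y)).
Proof. by move=> mh h0; exact: measurable_fun_fubini_tonelli_G. Qed.

End sigma_finite_product.

Section measure_preserving.
Local Open Scope ereal_scope.
Context d (X : measurableType d) (R : realType).
Variables (mu : {measure set X -> \bar R}) (phi : X -> X).
Hypothesis mphi : measurable_fun setT phi.
Hypothesis mu_phi : forall A, measurable A -> mu (phi @^-1` A) = mu A.

Lemma ge0_integral_measure_preserving (f : X -> \bar R) :
  measurable_fun setT f -> (forall x, 0 <= f x) ->
  \int[mu]_x f (phi x) = \int[mu]_x f x.
Proof.
move=> mf f0; transitivity (\int[pushforward mu phi]_x f x).
  by rewrite ge0_integral_pushforward// preimage_setT.
by apply: eq_measure_integral => A mA _; exact: mu_phi.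
Qed.

End measure_preserving.

Section translation_invariance.
Context {R : realType}.
Local Notation lam := (@lebesgue_measure R).

(** The translated measure agrees with Lebesgue measure on half-open intervals, which determine
    it. *)
Lemma lebesgue_measure_translation (a : R) (A : set (measurableTypeR R)) :
  measurable A -> lam ((fun x => x + a) @^-1` A) = lam A.
Proof.
move=> mA; pose phi : measurableTypeR R -> measurableTypeR R := fun x => x + a.
have mphi : measurable_fun setT phi by exact: measurable_funD.
pose phi_pack : {mfun _ >-> _} :=
  HB.pack phi (isMeasurableFun.Build _ _ _ _ _ mphi).
apply/esym; apply: (@lebesgue_measure_unique _ (pushforward lam phi_pack)) => //.
move=> _ [[b c]] _ <-.
transitivity (lam `](b - a), (c - a)]).
  by rewrite !lebesgue_measure_itv/= !lte_fin ltrD2r -!EFinD opprD opprK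
    addrACA (addrC _ a) subrr addr0.
congr (lam _); apply/seteqP; split=> x;
  by rewrite /= !in_itv/= /phi ltrBlDr lerBrDr.
Qed.

Lemma measurable_rV_add n (a : 'rV[R]_n) :
  measurable_fun setT (fun x : 'rV[R]_n => x + a).
Proof.
apply/measurable_fun_rVP => i; rewrite [X in measurable_fun _ X](_ : _ =
  rV_coord i \+ cst (a ord0 i)); last by apply/funext => x; rewrite /rV_coord/= mxE.
by apply: measurable_funD => //; exact: measurable_rV_coord.
Qed.

(** Induction on the dimension: through [rV_cons] the translation acts separately on head and tail,
    and a product measure is determined by its values on rectangles. *)
Lemma lebesgue_rV_translation n (a : 'rV[R]_n) (A : set 'rV[R]_n) :
  measurable A -> lebesgue_rV n ((fun x : 'rV[R]_n => x + a) @^-1` A) = lebesgue_rV n A.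
Proof.
elim: n a A => [|n IH] a A mA /=.
  by congr (dirac _ _); apply/seteqP; split=> x; rewrite /= (_ : x + a = x)//;
    apply/rowP => -[].
rewrite /lebesgue_rV_step.
pose a' : 'rV[R]_n := \row_i a ord0 (lift ord0 i).
pose phi (p : measurableTypeR R * 'rV[R]_n) : measurableTypeR R * 'rV[R]_n :=
  (p.1 + a ord0 ord0, p.2 + a').
have mphi : measurable_fun setT phi.
  apply: measurable_fun_pair; first exact: measurable_funD.
  exact: (measurableT_comp (measurable_rV_add _ a')).
have mcA : measurable (rV_cons (n := n) @^-1` A).
  by rewrite -[X in measurable X]setTI; exact: measurable_rV_cons.
pose phi_pack : {mfun _ >-> _} :=
  HB.pack phi (isMeasurableFun.Build _ _ _ _ _ mphi).
transitivity (pushforward (lam \x lebesgue_rV n)%E phi_pack (rV_cons (n := n) @^-1` A)).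
  congr ((_ \x _)%E _); apply/seteqP; split=> -[x v] /=;
  rewrite (_ : rV_cons (x, v) + a = rV_cons (phi (x, v)))//;
  apply/rowP => i; rewrite mxE; case: (unliftP ord0 i) => [j ->|->];
  by rewrite ?rV_consS ?rV_cons0//= mxE mxE.
apply/esym; apply: (@product_measure_unique _ _ _ _ _ lam (lebesgue_rV n)
  (pushforward (lam \x lebesgue_rV n)%E phi_pack)) => // B C mB mC.
pose B' : set (measurableTypeR R) := (fun x => x + a ord0 ord0) @^-1` B.
pose C' : set 'rV[R]_n := (fun v => v + a') @^-1` C.
transitivity ((lam \x lebesgue_rV n)%E (B' `*` C')).
  by congr ((_ \x _)%E _); apply/seteqP; split=> -[x v].
rewrite product_measure1E.
- by congr (_ * _)%E; [exact: lebesgue_measure_translation|exact: IH].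
- rewrite -[X in measurable X]setTI.
  exact: (@measurable_funD _ _ R setT id (cst _)).
- by rewrite -[X in measurable X]setTI; exact: measurable_rV_add.
Qed.

End translation_invariance.

(** * The Euclidean structure on row vectors *)

Section dot_product.
Context {R : realType} {n : nat}.
Notation V := 'rV[R]_n.
Implicit Types x y z v : V.

Definition dotp x y : R := \sum_(i < n) x ord0 i * y ord0 i.

Lemma sqnormE x : sqnorm x = dotp x x.
Proof. by apply: eq_bigr => i _; rewrite expr2. Qed.

Lemma sqnorm_ge0 x : 0 <= sqnorm x.
Proof. by apply: sumr_ge0 => i _; exact: sqr_ge0. Qed.

Lemma dotpC x y : dotp x y = dotp y x.
Proof. by apply: eq_bigr => i _; rewrite mulrC. Qed.

Lemma dotpDl x y z : dotp (x + y) z = dotp x z + dotp y z.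
Proof. by rewrite -big_split; apply: eq_bigr => i _; rewrite mxE mulrDl. Qed.

Lemma dotpZl (a : R) x y : dotp (a *: x) y = a * dotp x y.
Proof. by rewrite mulr_sumr; apply: eq_bigr => i _; rewrite mxE mulrA. Qed.

Lemma dotpDr x y z : dotp x (y + z) = dotp x y + dotp x z.
Proof. by rewrite dotpC dotpDl !(dotpC x). Qed.

Lemma dotpZr (a : R) x y : dotp x (a *: y) = a * dotp x y.
Proof. by rewrite dotpC dotpZl dotpC. Qed.

Lemma sqnorm_line z v (t : R) :
  sqnorm (z + t *: v) = sqnorm z + 2 * t * dotp z v + t ^+ 2 * sqnorm v.
Proof.
rewrite !sqnormE dotpDl !dotpDr !dotpZl !dotpZr (dotpC v z); ring.
Qed.

Lemma dotp_sqr_le x y : dotp x y ^+ 2 <= sqnorm x * sqnorm y.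
Proof.
have [y0|y0] := eqVneq (sqnorm y) 0.
  suff -> : dotp x y = 0 by rewrite expr0n y0 mulr0.
  apply: big1 => i _; suff -> : y ord0 i = 0 by rewrite mulr0.
  apply/eqP; rewrite -sqrf_eq0; move/eqP: y0; rewrite psumr_eq0.
    by move=> /allP/(_ i); rewrite mem_index_enum => /(_ isT).
  by move=> j _; exact: sqr_ge0.
have y1 : 0 < sqnorm y by rewrite lt_neqAle eq_sym y0 sqnorm_ge0.
(* Cauchy-Schwarz: this multiple of [y] minimises the norm of [x + s *: y] over [s]. *)
have := sqnorm_ge0 (x + (- (dotp x y / sqnorm y)) *: y).
rewrite sqnorm_line -(pmulr_rge0 _ y1).
suff -> : sqnorm y * (sqnorm x + 2 * - (dotp x y / sqnorm y) * dotp x y +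
  (- (dotp x y / sqnorm y)) ^+ 2 * sqnorm y) =
  sqnorm x * sqnorm y - dotp x y ^+ 2 by rewrite subr_ge0.
by field.
Qed.

(** Parallelogram identity: the difference of the two sides is [sqnorm (x + y)]. *)
Lemma sqnormB_le x y : sqnorm (x - y) <= 2 * (sqnorm x + sqnorm y).
Proof.
have := sqnorm_ge0 (x + 1 *: y); rewrite sqnorm_line => h.
rewrite -scaleN1r sqnorm_line; lra.
Qed.

Section measurability.
Context d (T : measurableType d).

Lemma measurable_rVD (f g : T -> V) : measurable_fun setT f ->
  measurable_fun setT g -> measurable_fun setT (fun w => f w + g w).
Proof.
move=> /measurable_fun_rVP mf /measurable_fun_rVP mg.
apply/measurable_fun_rVP => i; have := measurable_funD (mf i) (mg i).
by congr measurable_fun; apply/funext => w; rewrite /rV_coord /= mxE.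
Qed.

Lemma measurable_rVZ (a : T -> R) (f : T -> V) : measurable_fun setT a ->
  measurable_fun setT f -> measurable_fun setT (fun w => a w *: f w).
Proof.
move=> ma /measurable_fun_rVP mf.
apply/measurable_fun_rVP => i; have := measurable_funM ma (mf i).
by congr measurable_fun; apply/funext => w; rewrite /rV_coord /= mxE.
Qed.

Lemma measurable_rVB (f g : T -> V) : measurable_fun setT f ->
  measurable_fun setT g -> measurable_fun setT (fun w => f w - g w).
Proof.
move=> mf mg; under eq_fun do rewrite -scaleN1r.
by apply: measurable_rVD => //; exact: measurable_rVZ.
Qed.

Lemma measurable_dotp (f g : T -> V) : measurable_fun setT f ->
  measurable_fun setT g -> measurable_fun setT (fun w => dotp (f w) (g w)).
Proof.
move=> /measurable_fun_rVP mf /measurable_fun_rVP mg.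
by apply: measurable_sum => i; exact: measurable_funM (mf i) (mg i).
Qed.

Lemma measurable_sqnorm (f : T -> V) : measurable_fun setT f ->
  measurable_fun setT (fun w => sqnorm (f w)).
Proof. by move=> mf; under eq_fun do rewrite sqnormE; exact: measurable_dotp. Qed.

End measurability.

End dot_product.

(** * Free transport preserves phase-space volume *)

Section shear_invariance.
Local Open Scope ereal_scope.
Context {R : realType} {n : nat}.
Notation V := 'rV[R]_n.
Notation leb := (lebesgue_rV (R := R) n).
Notation phase := (sigma_finite_prod leb leb).

Lemma measurable_shear (t : R) :
  measurable_fun setT (fun p : V * V => ((p.1 + t *: p.2)%R, p.2)).
Proof.
apply: measurable_fun_pair => //; apply: measurable_rVD => //.
exact: measurable_rVZ.
Qed.

(** At fixed velocity [xi] the shear is the translation of [x] by [t *: xi], so integrate in [x]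
    first. *)
Let ge0_integral_shear (t : R) (h : V * V -> \bar R) :
  measurable_fun setT h -> (forall p, 0 <= h p) ->
  \int[phase]_p h ((p.1 + t *: p.2)%R, p.2) = \int[phase]_p h p.
Proof.
move=> mh h0.
rewrite (tonelli21 _ _ (fun p : V * V => h ((p.1 + t *: p.2)%R, p.2)))//; last first.
  exact: (measurableT_comp mh (measurable_shear t)).
rewrite tonelli21//; apply: eq_integral => xi _ /=.
apply: (@ge0_integral_measure_preserving _ _ _ leb (fun x : V => x + t *: xi)%R
  _ _ (fun x => h (x, xi))) => //.
- exact: measurable_rV_add.
- by move=> A mA; exact: lebesgue_rV_translation.
- exact: measurableT_comp.
Qed.

Lemma integral_shear (t : R) (h : V * V -> \bar R) : measurable_fun setT h ->
  \int[phase]_p h ((p.1 + t *: p.2)%R, p.2) = \int[phase]_p h p.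
Proof.
move=> mh; rewrite integralE [RHS]integralE; congr (_ - _).
- rewrite -(@ge0_integral_shear t h^\+ (measurable_funepos mh))//.
  by apply: eq_integral => p _; rewrite !funeposE.
- rewrite -(@ge0_integral_shear t h^\- (measurable_funeneg mh))//.
  by apply: eq_integral => p _; rewrite !funenegE.
Qed.

End shear_invariance.

(** * The Morawetz kernel *)

Section real_derivatives.
Context {R : realType}.
Implicit Types (f g : R -> R) (t a b : R).

Lemma is_derive_fun_add {f g t a b} : is_derive t 1 f a -> is_derive t 1 g b ->
  is_derive t 1 (fun s => f s + g s) (a + b).
Proof. exact: is_deriveD. Qed.

Lemma is_derive_fun_mul {f g t a b} : is_derive t 1 f a -> is_derive t 1 g b ->
  is_derive t 1 (fun s => f s * g s) (f t * b + g t * a).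
Proof. exact: is_deriveM. Qed.

End real_derivatives.

Section morawetz_kernel.
Context {R : realType} {n : nat}.
Notation V := 'rV[R]_n.
Variable r : R.
Hypothesis r0 : 0 < r.
Implicit Types x y z v : V.

(** The kernel [|z|] would be singular at 0 and its Hessian would vanish in the radial direction.
    Smoothing at the radius [r] of the ball cures both, with a Hessian of order [1 / r] on the
    ball. *)
Definition smooth_norm z : R := Num.sqrt (r ^+ 2 + sqnorm z).

(* For phi = smooth_norm, these are v . grad phi(z) and v . (Hess phi(z)) v. *)
Definition morawetz z v : R := dotp z v / smooth_norm z.
Definition morawetz_hess z v : R :=
  sqnorm v / smooth_norm z - dotp z v ^+ 2 / smooth_norm z ^+ 3.

Lemma smooth_norm_sqr z : smooth_norm z ^+ 2 = r ^+ 2 + sqnorm z.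
Proof. by rewrite sqr_sqrtr// addr_ge0 ?sqnorm_ge0// sqr_ge0. Qed.

Lemma smooth_norm_ge z : r <= smooth_norm z.
Proof.
rewrite -(@ler_pXn2r _ 2) ?nnegrE ?sqrtr_ge0 ?(ltW r0)//.
by rewrite smooth_norm_sqr lerDl sqnorm_ge0.
Qed.

Lemma smooth_norm_gt0 z : 0 < smooth_norm z.
Proof. exact: lt_le_trans (smooth_norm_ge z). Qed.

Lemma morawetzNN z v : morawetz (- z) (- v) = morawetz z v.
Proof.
rewrite /morawetz /smooth_norm -(scaleN1r z) -(scaleN1r v) !sqnormE.
by rewrite !dotpZl !dotpZr !mulN1r !opprK.
Qed.

Lemma morawetz_sqr_le z v : morawetz z v ^+ 2 <= sqnorm v.
Proof.
rewrite expr_div_n ler_pdivrMr ?exprn_gt0 ?smooth_norm_gt0//.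
rewrite smooth_norm_sqr (le_trans (dotp_sqr_le z v))// mulrC.
by rewrite ler_wpM2l ?sqnorm_ge0// lerDr sqr_ge0.
Qed.

(** By Cauchy-Schwarz the kernel is at most [|x - y|], and [|x - y|^2 <= 2 (|x|^2 + |y|^2) <= (1 +
    |x|^2 + |y|^2)^2]. The product form of the bound lets pair integrals factor. *)
Lemma morawetz_le x y z : `|morawetz z (x - y)| <= (1 + sqnorm x) * (1 + sqnorm y).
Proof.
have [x0 y0] := (sqnorm_ge0 x, sqnorm_ge0 y).
have w0 : 0 <= (1 + sqnorm x) * (1 + sqnorm y) by rewrite mulr_ge0// addr_ge0.
rewrite -(@ler_pXn2r _ 2) ?nnegrE// -normrX ger0_norm ?sqr_ge0//.
apply: le_trans (morawetz_sqr_le _ _) _; apply: le_trans (sqnormB_le _ _) _.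
have xy0 := mulr_ge0 x0 y0.
apply: (@le_trans _ _ ((1 + (sqnorm x + sqnorm y)) ^+ 2)).
  rewrite sqrrD expr1n mul1r -mulr_natl; have := sqr_ge0 (sqnorm x + sqnorm y); lra.
rewrite ler_pXn2r ?nnegrE ?addr_ge0// mulrDl mulrDr; lra.
Qed.

Lemma morawetz_hessE z v : morawetz_hess z v =
  ((r ^+ 2 + sqnorm z) * sqnorm v - dotp z v ^+ 2) / smooth_norm z ^+ 3.
Proof.
rewrite /morawetz_hess -smooth_norm_sqr; field.
by rewrite lt0r_neq0// smooth_norm_gt0.
Qed.

(** Cauchy-Schwarz absorbs [dotp z v ^+ 2] into [sqnorm z * sqnorm v]; what the smoothing added,
    [r ^+ 2 * sqnorm v], survives in every direction. *)
Lemma morawetz_hess_ge z v :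
  r ^+ 2 * sqnorm v / smooth_norm z ^+ 3 <= morawetz_hess z v.
Proof.
rewrite morawetz_hessE ler_pM2r ?invr_gt0 ?exprn_gt0 ?smooth_norm_gt0//.
by rewrite mulrDl -addrA lerDl subr_ge0 dotp_sqr_le.
Qed.

Lemma morawetz_hess_ge0 z v : 0 <= morawetz_hess z v.
Proof.
apply: le_trans (morawetz_hess_ge z v).
by rewrite !mulr_ge0 ?invr_ge0 ?exprn_ge0 ?sqnorm_ge0 ?(ltW (smooth_norm_gt0 _))// ltW.
Qed.

(** Serves integrability only: drop the negative term and use [r <= smooth_norm z]. *)
Lemma morawetz_hess_le x y z :
  morawetz_hess z (x - y) <= 2 / r * ((1 + sqnorm x) * (1 + sqnorm y)).
Proof.
have [x0 y0] := (sqnorm_ge0 x, sqnorm_ge0 y).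
apply: (@le_trans _ _ (sqnorm (x - y) / r)).
  rewrite /morawetz_hess lerBlDr -[leLHS]addr0 lerD//.
    by rewrite ler_wpM2l ?sqnorm_ge0// lef_pV2 ?posrE ?smooth_norm_gt0// smooth_norm_ge.
  by rewrite divr_ge0 ?sqr_ge0// exprn_ge0// ltW// smooth_norm_gt0.
rewrite mulrAC ler_pM2r ?invr_gt0//.
apply: le_trans (sqnormB_le _ _) _; have := mulr_ge0 x0 y0; lra.
Qed.

(** On the ball [smooth_norm z ^+ 2 <= 2 * r ^+ 2], hence [smooth_norm z <= 2 * r] and the cube in
    [morawetz_hess_ge] is at most [4 * r ^+ 3]. *)
Lemma sqnorm_le_morawetz_hess z v : Num.sqrt (sqnorm z) < r ->
  sqnorm v <= 4 * r * morawetz_hess z v.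
Proof.
move=> zr.
have z2 : sqnorm z < r ^+ 2.
  rewrite -[ltLHS]sqr_sqrtr ?sqnorm_ge0//.
  by rewrite ltr_pXn2r// nnegrE ?sqrtr_ge0// ltW.
have p0 := smooth_norm_gt0 z.
have p2 := smooth_norm_sqr z.
have p_le : smooth_norm z <= 2 * r.
  rewrite -(@ler_pXn2r _ 2) ?nnegrE ?(ltW p0) ?mulr_ge0 ?(ltW r0)//.
  by rewrite p2 exprMn; have := sqr_ge0 r; lra.
apply: le_trans (ler_wpM2l _ (morawetz_hess_ge z v)); last by rewrite mulr_ge0// ltW.
have -> : 4 * r * (r ^+ 2 * sqnorm v / smooth_norm z ^+ 3) =
  (4 * r ^+ 3 / smooth_norm z ^+ 3) * sqnorm v by ring.
rewrite -[leLHS]mul1r ler_wpM2r ?sqnorm_ge0//.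
rewrite ler_pdivlMr ?exprn_gt0// mul1r.
rewrite exprSr p2 (_ : 4 * r ^+ 3 = (2 * r ^+ 2) * (2 * r)); last by ring.
by apply: ler_pM => //; [rewrite addr_ge0 ?sqr_ge0 ?sqnorm_ge0|exact: ltW|lra].
Qed.

(** Along the line the numerator [N] is affine with slope [sqnorm v], and the squared denominator
    [q] is quadratic with [q' = 2 N]; so [N / sqrt q] has derivative
    [sqnorm v / sqrt q - N^2 / q^(3/2)]. *)
Lemma is_derive_morawetz z v (t : R) :
  is_derive t 1 (fun s => morawetz (z + s *: v) v) (morawetz_hess (z + t *: v) v).
Proof.
pose q s := r ^+ 2 + (sqnorm z + 2 * s * dotp z v + s * s * sqnorm v).
pose N s := dotp z v + s * sqnorm v.
have qE s : r ^+ 2 + sqnorm (z + s *: v) = q s by rewrite sqnorm_line.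
have NE s : dotp (z + s *: v) v = N s by rewrite dotpDl dotpZl -sqnormE.
have did : is_derive t 1 (fun s => s) (1 : R) by exact: is_derive_id.
have dcst (c : R) : is_derive t 1 (fun _ : R => c) (0 : R) by exact: is_derive_cst.
have dN : is_derive t 1 N (sqnorm v).
  apply: is_derive_eq (is_derive_fun_add (dcst _) (is_derive_fun_mul did (dcst _))) _.
  by ring.
have dq : is_derive t 1 q (2 * N t).
  apply: is_derive_eq (is_derive_fun_add (dcst _) (is_derive_fun_add
    (is_derive_fun_add (dcst _)
      (is_derive_fun_mul (is_derive_fun_mul (dcst _) did) (dcst _)))
    (is_derive_fun_mul (is_derive_fun_mul did did) (dcst _)))) _.
  by rewrite /N; ring.
have q0 : 0 < q t by rewrite -qE -smooth_norm_sqr exprn_gt0// smooth_norm_gt0.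
have dV : is_derive t 1 (fun s => (Num.sqrt (q s))^-1)
    (- (Num.sqrt (q t)) ^- 2 * ((2 * Num.sqrt (q t))^-1 * (2 * N t))).
  apply: is_deriveV; first by rewrite lt0r_neq0// sqrtr_gt0.
  have dS := is_derive1_sqrt q0.
  exact: is_derive1_comp.
have -> : (fun s => morawetz (z + s *: v) v) =
    (fun s => N s * (Num.sqrt (q s))^-1).
  by apply/funext => s; rewrite /morawetz /smooth_norm NE qE.
apply: is_derive_eq (is_derive_fun_mul dN dV) _.
rewrite /morawetz_hess /smooth_norm NE qE; field.
by rewrite lt0r_neq0// sqrtr_gt0.
Qed.

Section measurability.
Context d (T : measurableType d) (f g : T -> V).
Hypotheses (mf : measurable_fun setT f) (mg : measurable_fun setT g).

Let measurable_smooth_normV :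
  measurable_fun setT (fun w => (smooth_norm (f w))^-1).
Proof.
under eq_fun do rewrite -powR_inv1 ?(ltW (smooth_norm_gt0 _))//
  /smooth_norm -powR12_sqrt ?addr_ge0 ?sqr_ge0 ?sqnorm_ge0//.
apply: (measurableT_comp (measurable_powR (-1))).
apply: (measurableT_comp (measurable_powR 2^-1)).
by apply: measurable_funD => //; exact: measurable_sqnorm.
Qed.

Lemma measurable_morawetz : measurable_fun setT (fun w => morawetz (f w) (g w)).
Proof. by apply: measurable_funM => //; exact: measurable_dotp. Qed.

Lemma measurable_morawetz_hess :
  measurable_fun setT (fun w => morawetz_hess (f w) (g w)).
Proof.
apply: measurable_funB.
  by apply: measurable_funM => //; exact: measurable_sqnorm.
under eq_fun do rewrite -exprVn.
by apply: measurable_funM; apply: measurable_funX => //; exact: measurable_dotp.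
Qed.

End measurability.
End morawetz_kernel.

(** * Phase space integrals *)

Section integral_complements.
Local Open Scope ereal_scope.
Context d (X : measurableType d) (R : realType).
Variable mu : {measure set X -> \bar R}.

(* The integral of a nonnegative function is a supremum over simple minorants,
   hence monotone even when the smaller function is not measurable. *)
Lemma ge0_le_integral_nonmeasurable (D : set X) (g h : X -> \bar R) :
  (forall x, D x -> 0 <= g x) -> (forall x, D x -> g x <= h x) ->
  \int[mu]_(x in D) g x <= \int[mu]_(x in D) h x.
Proof.
move=> g0 gh.
rewrite integral_mkcond [leRHS]integral_mkcond.
have gD0 x : 0 <= (g \_ D) x.
  by rewrite patchE; case: ifPn => // /set_mem; exact: g0.
have gDh x : (g \_ D) x <= (h \_ D) x.
  by rewrite !patchE; case: ifPn => // /set_mem; exact: gh.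
rewrite !ge0_integralTE//; last by move=> x; exact: le_trans (gDh x).
apply: le_ereal_sup => _ [s /= sg <-]; exists s => //= x.
exact: le_trans (sg x) (gDh x).
Qed.

(** A difference of extended reals is finite only if both terms are, so a finite integral bounds the
    positive and the negative part. This is how the vanishing moments of [mesoscopic] yield
    integrability. *)
Lemma integrable_integral_fin_num (g : X -> \bar R) :
  measurable_fun setT g -> \int[mu]_x g x \is a fin_num ->
  mu.-integrable setT g.
Proof.
move=> mg; rewrite integralE fin_numB => /andP[gp gn].
apply/integrableP; split => //.
under eq_integral do rewrite -[`|_|]/((abse \o g) _) fune_abse.
rewrite ge0_integralD//; last 2 first.
- exact: measurable_funepos.
- exact: measurable_funeneg.
by rewrite lte_add_pinfty// ltey_eq ?gp ?gn.
Qed.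

Lemma dominated_integrable (g h : X -> R) :
  measurable_fun setT g -> (forall x, `|g x| <= h x)%R ->
  \int[mu]_x (h x)%:E < +oo -> mu.-integrable setT (fun x => (g x)%:E).
Proof.
move=> mg gh hoo; apply/integrableP; split; first exact/measurable_EFinP.
apply: le_lt_trans hoo.
by apply: ge0_le_integral_nonmeasurable => x _; rewrite abse_EFin lee_fin.
Qed.

End integral_complements.

Section tensor_product.
Local Open Scope ereal_scope.
Context d (X : measurableType d) (R : realType).
Variable mu : {sigma_finite_measure set X -> \bar R}.

Lemma ge0_integral_tensor (a b : X -> R) :
  measurable_fun setT a -> measurable_fun setT b ->
  (forall x, 0 <= a x)%R -> (forall x, 0 <= b x)%R ->
  \int[sigma_finite_prod mu mu]_q (a q.1 * b q.2)%:E =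
  \int[mu]_x (a x)%:E * \int[mu]_x (b x)%:E.
Proof.
move=> ma mb a0 b0.
rewrite (tonelli12 _ _ (fun q : X * X => (a q.1 * b q.2)%:E)); last 2 first.
- apply/measurable_EFinP; apply: measurable_funM; exact: measurableT_comp.
- by move=> q; rewrite lee_fin mulr_ge0.
have a0' x : 0 <= (a x)%:E by rewrite lee_fin.
have b0' x : 0 <= (b x)%:E by rewrite lee_fin.
have [ma' mb'] := ((measurable_EFinP _ a).2 ma, (measurable_EFinP _ b).2 mb).
rewrite -ge0_integralZr//; last by apply: integral_ge0 => x _; rewrite lee_fin.
apply: eq_integral => x _; rewrite /= -ge0_integralZl//.
Qed.

End tensor_product.

Section phase_space.
Context {R : realType} {n : nat}.
Notation V := 'rV[R]_n.
Notation P := (V * V)%type.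
Notation leb := (lebesgue_rV (R := R) n).
Notation phase := (sigma_finite_prod leb leb).
Implicit Types (g : V -> V -> R -> R) (p : P) (t : R).

(** Dominates both mass and energy densities, and depends on the velocity alone, hence is constant
    along characteristics. *)
Definition weight p : R := 1 + sqnorm p.2.

(** Lagrangian coordinates: [p] holds the position at time 0 and the constant velocity. *)
Definition along g p t : R := g (p.1 + t *: p.2) p.2 t.

Lemma weight_ge1 p : 1 <= weight p.
Proof. by rewrite lerDl sqnorm_ge0. Qed.

Lemma weight_ge0 p : 0 <= weight p.
Proof. exact: le_trans (weight_ge1 p). Qed.

Lemma measurable_weight : measurable_fun setT weight.
Proof. by apply: measurable_funD => //; exact: measurable_sqnorm. Qed.

Lemma measurable_max0 : measurable_fun setT (fun t => Num.max t 0).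
Proof. exact: measurable_maxr. Qed.

(* Phase functions are only known to be measurable for nonnegative times, hence
   the truncation max(t, 0). *)
Lemma measurable_truncated g : phase_measurable g ->
  measurable_fun setT (fun z : P * R => g z.1.1 z.1.2 (Num.max z.2 0)).
Proof.
move=> mg.
pose D : set (P * R) := [set z | 0 <= z.2].
have mD : measurable D.
  rewrite (_ : D = snd @^-1` `[0, +oo[%classic); last first.
    by apply/seteqP; split => z; rewrite /= in_itv/= andbT.
  by rewrite -[X in measurable X]setTI; exact: measurable_snd.
apply: (@measurable_comp _ _ _ _ _ _ D (fun z => g z.1.1 z.1.2 z.2) _
  (fun z : P * R => (z.1, Num.max z.2 0))) => //.
- by move=> _ [z _ <-]; rewrite /D /= le_max lexx orbT.
- apply: measurable_fun_pair => //.
  exact: (measurableT_comp measurable_max0).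
Qed.

Lemma measurable_along g : phase_measurable g ->
  measurable_fun setT (fun z : P * R => along g z.1 (Num.max z.2 0)).
Proof.
move=> mg; pose S (z : P * R) : P * R :=
  ((z.1.1 + Num.max z.2 0 *: z.1.2, z.1.2), z.2).
suff mS : measurable_fun setT S.
  exact: (measurableT_comp (measurable_truncated _ mg) mS).
apply: measurable_fun_pair => //; apply: measurable_fun_pair; last first.
  exact: measurableT_comp.
apply: measurable_rVD; first exact: measurableT_comp.
apply: measurable_rVZ; last exact: measurableT_comp.
exact: (measurableT_comp measurable_max0).
Qed.

Lemma measurable_slice g t : phase_measurable g -> 0 <= t ->
  measurable_fun setT (fun p => g p.1 p.2 t).
Proof.
move=> mg t0; have := measurableT_comp (measurable_truncated _ mg)
  (measurable_fun_pair (@measurable_id _ P setT) (measurable_cst t)).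
by congr measurable_fun; apply/funext => p /=; rewrite max_l.
Qed.

Lemma measurable_along_slice g t : phase_measurable g -> 0 <= t ->
  measurable_fun setT (along g ^~ t).
Proof.
move=> mg t0; have := measurableT_comp (measurable_along _ mg)
  (measurable_fun_pair (@measurable_id _ P setT) (measurable_cst t)).
by congr measurable_fun; apply/funext => p /=; rewrite max_l.
Qed.

Lemma integral_along g (h : P -> R) t : phase_measurable g -> 0 <= t ->
  measurable_fun setT h ->
  (\int[phase]_p (along g p t * h ((p.1 + t *: p.2)%R, p.2))%:E =
   \int[phase]_p (g p.1 p.2 t * h p)%:E)%E.
Proof.
move=> mg t0 mh; have := integral_shear t (fun p => (g p.1 p.2 t * h p)%:E); apply.
by apply/measurable_EFinP/measurable_funM => //; exact: measurable_slice.
Qed.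

End phase_space.

(** * Conservation laws and the interaction estimate *)

Section kinetic_estimates.
Context {R : realType} {n : nat}.
Notation V := 'rV[R]_n.
Notation P := (V * V)%type.
Notation leb := (lebesgue_rV (R := R) n).
Notation phase := (sigma_finite_prod leb leb).
Notation lam := (@lebesgue_measure R).
Variables (I : (V -> V -> R -> R) -> V -> V -> R -> R) (f : V -> V -> R -> R).
Variables (f0 : V -> V -> R) (M E : R).
Hypothesis f_ge0 : forall x xi t, 0 <= t -> 0 <= f x xi t.
Hypothesis sol : transport_solution I f f0.
Hypothesis meso : mesoscopic I f.
Hypothesis intI : integrable_interaction I f.
Hypothesis mass : total_mass (fun x xi => f x xi 0) = M%:E.
Hypothesis energy : total_energy (fun x xi => f x xi 0) = E%:E.

Let mf : phase_measurable f. Proof. by case: sol. Qed.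
Let mI : phase_measurable (I f). Proof. by case: intI. Qed.
Let mnI : phase_measurable (fun x xi t => `|I f x xi t|).
Proof. exact: measurableT_comp. Qed.

Let F := along f.
Let J := along (I f).

Let F_ge0 p t : 0 <= t -> 0 <= F p t. Proof. exact: f_ge0. Qed.

Let initial_weight : (\int[phase]_p (f p.1 p.2 0 * weight p)%:E = (M + E)%:E)%E.
Proof.
have mf0 := measurable_slice f 0 mf (lexx 0).
have mE : measurable_fun setT (fun p : P => f p.1 p.2 0 * sqnorm p.2).
  by apply: measurable_funM => //; exact: measurable_sqnorm.
have p0 (p : P) : 0 <= f p.1 p.2 0 * sqnorm p.2.
  by rewrite mulr_ge0 ?sqnorm_ge0// f_ge0.
rewrite EFinD -mass -energy /total_mass /total_energy.
rewrite -(tonelli21 _ _ (fun p : P => (f p.1 p.2 0)%:E)); last 2 first.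
- exact/measurable_EFinP.
- by move=> p; rewrite lee_fin f_ge0.
rewrite -(tonelli21 _ _ (fun p : P => (f p.1 p.2 0 * sqnorm p.2)%:E)); last 2 first.
- exact/measurable_EFinP.
- by move=> p; rewrite lee_fin.
rewrite -ge0_integralD//; last 4 first.
- by move=> p _; rewrite lee_fin f_ge0.
- exact/measurable_EFinP.
- by move=> p _; rewrite lee_fin.
- exact/measurable_EFinP.
by apply: eq_integral => p _; rewrite -EFinD /weight mulrDr mulr1.
Qed.

Let interaction_slice t : 0 <= t ->
  (\int[phase]_p (`|J p t| * weight p)%:E =
   \int[leb]_x \int[leb]_xi (`|I f x xi t| * (1 + sqnorm xi))%:E)%E.
Proof.
move=> t0; have := integral_along _ _ _ mnI t0 measurable_weight.
rewrite /along /= => ->.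
rewrite (tonelli12 _ _ (fun p : P => (`|I f p.1 p.2 t| * weight p)%:E))//.
  apply/measurable_EFinP/measurable_funM; last exact: measurable_weight.
  exact: (measurable_slice _ _ mnI).
by move=> p; rewrite lee_fin mulr_ge0// weight_ge0.
Qed.

Let interaction_lty T : 0 < T ->
  (\int[lam]_(t in `[0%R, T]) \int[phase]_p (`|J p t| * weight p)%:E < +oo)%E.
Proof.
move=> T0; apply: le_lt_trans (intI.2 T T0).
rewrite le_eqVlt; apply/orP; left; apply/eqP; apply: eq_integral => t.
by rewrite inE/= in_itv/= => /andP[t0 _]; exact: interaction_slice.
Qed.

Let mJ : measurable_fun setT (fun z : P * R => J z.1 (Num.max z.2 0)).
Proof. exact: measurable_along. Qed.

(** A nonnegative function with finite time integral is finite almost everywhere. These are the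
    times at which Fubini may be applied to [I] over phase space. *)
Let interaction_ae T : 0 < T ->
  {ae lam, forall t, `[0, T]%classic t ->
    (\int[phase]_p (`|J p t| * weight p)%:E < +oo)%E}.
Proof.
move=> T0.
pose j t := (\int[phase]_p (`|J p (Num.max t 0)| * weight p)%:E)%E.
have j0 t : (0 <= j t)%E.
  by apply: integral_ge0 => p _; rewrite lee_fin mulr_ge0// weight_ge0.
have jE t : `[0, T]%classic t -> j t = (\int[phase]_p (`|J p t| * weight p)%:E)%E.
  by rewrite /= in_itv/= => /andP[t0 _]; rewrite /j max_l.
have mj : measurable_fun setT j.
  pose G (z : P * R) := (`|J z.1 (Num.max z.2 0)| * weight z.1)%:E.
  have mG : measurable_fun setT G.
    apply/measurable_EFinP/measurable_funM; first exact: measurableT_comp mJ.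
    exact: (measurableT_comp measurable_weight).
  have G0 z : (0 <= G z)%E by rewrite lee_fin mulr_ge0// weight_ge0.
  exact: (measurable_integral1 phase G).
have ij : lam.-integrable `[0, T] j.
  apply/integrableP; split; first exact: measurable_funTS mj.
  under eq_integral do rewrite gee0_abs//.
  apply: le_lt_trans (interaction_lty T T0).
  rewrite le_eqVlt; apply/orP; left; apply/eqP.
  by apply: eq_integral => t /set_mem; exact: jE.
have : {ae lam, forall t, `[0, T]%classic t -> j t \is a fin_num}.
  exact: integrable_ae.
by apply: (@filterS _ _ (ae_filter_ringOfSetsType lam)) => t jt tT;
  rewrite -jE// ltey_eq jt.
Qed.

Let moment_integrable x t : 0 <= t ->
  leb.-integrable setT (fun xi => (I f x xi t)%:E) /\
  forall i, leb.-integrable setT (fun xi => (I f x xi t * xi ord0 i)%:E).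
Proof.
move=> t0; have [m0 _ m1] := meso x t t0.
have mIx : measurable_fun setT (fun xi => I f x xi t).
  exact: (measurableT_comp (measurable_slice _ _ mI t0) (pair1_measurable x)).
split=> [|i]; apply: integrable_integral_fin_num; rewrite ?m0 ?m1//.
  exact/measurable_EFinP.
by apply/measurable_EFinP/measurable_funM => //; exact: measurable_rV_coord.
Qed.

(** Undoing the shear returns to fixed positions; the growth bound on [psi] makes [I * psi]
    integrable over phase space, so Fubini may integrate in [xi] first, where the cancellation
    holds. *)
Let interaction_cancel t (psi : P -> R) (C : R) : 0 <= t ->
  (\int[phase]_p (`|J p t| * weight p)%:E < +oo)%E ->
  measurable_fun setT psi -> (forall p, `|psi p| <= C * weight p) ->
  (forall x, \int[leb]_xi (I f x xi t * psi (x, xi))%:E = 0)%E ->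
  (\int[phase]_p (J p t * psi ((p.1 + t *: p.2)%R, p.2))%:E = 0)%E.
Proof.
move=> t0 Joo mpsi psiC psi0; rewrite integral_along//.
have mIt := measurable_slice _ _ mI t0.
have iIw : phase.-integrable setT (fun p => (`|I f p.1 p.2 t| * weight p)%:E).
  apply/integrableP; split.
    apply/measurable_EFinP/measurable_funM; last exact: measurable_weight.
    exact: measurableT_comp.
  under eq_integral do rewrite gee0_abs ?lee_fin ?mulr_ge0 ?weight_ge0//.
  have := integral_along _ _ _ mnI t0 measurable_weight.
  by rewrite /along /= => <-.
have iIpsi : phase.-integrable setT (fun p => (I f p.1 p.2 t * psi p)%:E).
  apply: (le_integrable _ _ _ (integrableZl _ C iIw)) => //.
    exact/measurable_EFinP/measurable_funM.
  move=> p _; rewrite -EFinM !abse_EFin lee_fin mulrCA normrM [leRHS]normrM normr_id.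
  by rewrite ler_wpM2l// (le_trans (psiC p))// ler_norm.
rewrite (fubini12 _ _ _ iIpsi); apply: integral0_eq => x _.
exact: psi0.
Qed.

Let F_continuous (p : P) (T : R) : {within `[0, T], continuous (F p)}.
Proof.
have [_ _ cF _] := sol; apply: continuous_subspaceW (cF p.1 p.2).
by move=> t; rewrite /= !in_itv/= andbT => /andP[].
Qed.

Let F_derive (p : P) (t : R) : 0 < t -> is_derive t 1 (F p) (J p t).
Proof. by have [_ _ _ dF] := sol; exact: dF. Qed.

(** The weight is constant along characteristics, so the derivative is [J * weight]. Its phase-space
    integral vanishes for almost every time by the mass and energy moments, and the integrated rate
    [g] is 0. *)
Let conservation (t : R) : 0 <= t ->
  (\int[phase]_p (F p t * weight p)%:E = (M + E)%:E)%E.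
Proof.
rewrite le_eqVlt => /predU1P[<-|t0].
  rewrite -initial_weight; apply: eq_integral => p _.
  by rewrite /F /along scale0r addr0.
have mFt s : 0 <= s -> measurable_fun setT (fun p => F p s * weight p).
  move=> s0; apply: measurable_funM; last exact: measurable_weight.
  exact: measurable_along_slice.
have F0E p : F p 0 = f p.1 p.2 0 by rewrite /F /along scale0r addr0.
have dFw (p : P) s : 0 < s < t -> is_derive s 1 (fun s => F p s * weight p)
    (J p (Num.max s 0) * weight p).
  move=> /andP[s0 st]; rewrite max_l ?(ltW s0)//.
  apply: is_derive_eq (is_derive_fun_mul (F_derive p s s0) (is_derive_cst _ _ _)) _.
  by rewrite mulr0 add0r mulrC.
transitivity (\int[phase]_p (F p 0 * weight p)%:E +
    \int[lam]_(s in `[0%R, t]) 0)%E; last first.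
  rewrite integral0 adde0 -initial_weight.
  by apply: eq_integral => p _; rewrite F0E.
apply: (@integral_derivative_in_time _ _ _ phase (fun p s => F p s * weight p)
  (fun z => J z.1 (Num.max z.2 0) * weight z.1) (fun=> 0%E) t t0 _ dFw).
- by move=> p s; apply: cvgM; [exact: F_continuous|exact: cvg_cst].
- apply: measurable_funM; first exact: mJ.
  exact: (measurableT_comp measurable_weight).
- exact: (mFt t (ltW t0)).
- apply/integrableP; split; first exact: ((measurable_EFinP _ _).2 (mFt 0 (lexx 0))).
  under eq_integral do rewrite gee0_abs ?lee_fin ?mulr_ge0 ?weight_ge0 ?F_ge0//.
  by under eq_integral do rewrite F0E; rewrite initial_weight ltry.
- apply: le_lt_trans (interaction_lty t t0).
  rewrite le_eqVlt; apply/orP; left; apply/eqP; apply: eq_integral => s.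
  rewrite inE/= in_itv/= => /andP[s0 _]; apply: eq_integral => p _.
  by rewrite max_l// normrM (ger0_norm (weight_ge0 p)).
- exact: measurable_cst.
- apply: (@filterS _ _ (ae_filter_ringOfSetsType lam)) (interaction_ae t t0) => s Js.
  move=> sT; have s0 : 0 <= s by move: sT; rewrite /= in_itv/= => /andP[].
  under eq_integral do rewrite /= max_l//.
  apply: (interaction_cancel s weight 1) => //.
  + exact: Js.
  + exact: measurable_weight.
  + by move=> p; rewrite mul1r ger0_norm ?weight_ge0.
  + move=> x; have [m0 m2 _] := meso x s s0; have [i0 _] := moment_integrable x s s0.
    rewrite -[RHS]adde0 -{1}m0 -{1}m2 -integralD//; last first.
      apply: integrable_integral_fin_num; last by rewrite m2.
      apply/measurable_EFinP/measurable_funM; last exact: measurable_sqnorm.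
      exact: (measurableT_comp (measurable_slice _ _ mI s0) (pair1_measurable x)).
    by apply: eq_integral => xi _; rewrite -EFinD /weight mulrDr mulr1.
Qed.

(** * Pairs of particles and the derivative of the action *)

Variable r : R.
Hypothesis r0 : 0 < r.

Notation pairs := (sigma_finite_prod phase phase).

(** Relative position at time [t] of two particles in free motion: a line whose direction is the
    relative velocity, as [is_derive_morawetz] requires. *)
Let disp (q : P * P) (t : R) : V := q.1.1 - q.2.1 + t *: (q.1.2 - q.2.2).
Let B (q : P * P) (t : R) : R := morawetz r (disp q t) (q.1.2 - q.2.2).
Let H (q : P * P) (t : R) : R := morawetz_hess r (disp q t) (q.1.2 - q.2.2).
Let Fw (t : R) (p : P) : R := F p t * weight p.
Let Jw (t : R) (p : P) : R := `|J p t| * weight p.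

Let B_le q t : `|B q t| <= weight q.1 * weight q.2.
Proof. exact: morawetz_le. Qed.

Let H_le q t : H q t <= 2 / r * (weight q.1 * weight q.2).
Proof. exact: morawetz_hess_le. Qed.

Let H_ge0 q t : 0 <= H q t. Proof. exact: morawetz_hess_ge0. Qed.

Let Fw_ge0 t p : 0 <= t -> 0 <= Fw t p.
Proof. by move=> t0; rewrite mulr_ge0 ?weight_ge0 ?F_ge0. Qed.

Let Jw_ge0 t p : 0 <= Jw t p. Proof. by rewrite mulr_ge0 ?weight_ge0. Qed.

Let measurable_Fw t : 0 <= t -> measurable_fun setT (Fw t).
Proof.
move=> t0; apply: measurable_funM; last exact: measurable_weight.
exact: measurable_along_slice.
Qed.

Let measurable_Jw t : 0 <= t -> measurable_fun setT (Jw t).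
Proof.
move=> t0; apply: measurable_funM; last exact: measurable_weight.
by apply: measurableT_comp => //; exact: measurable_along_slice.
Qed.

Let measurable_pair1 : measurable_fun setT (fun z : P * P * R => z.1.1).
Proof. exact: (measurableT_comp measurable_fst measurable_fst). Qed.

Let measurable_pair2 : measurable_fun setT (fun z : P * P * R => z.1.2).
Proof. exact: (measurableT_comp measurable_snd measurable_fst). Qed.

Let measurable_vel :
  measurable_fun setT (fun z : P * P * R => z.1.1.2 - z.1.2.2).
Proof.
by apply: measurable_rVB; apply: (measurableT_comp measurable_snd).
Qed.

Let measurable_disp :
  measurable_fun setT (fun z : P * P * R => disp z.1 (Num.max z.2 0)).
Proof.
apply: measurable_rVD.
  by apply: measurable_rVB; apply: (measurableT_comp measurable_fst).
apply: measurable_rVZ; last exact: measurable_vel.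
exact: (measurableT_comp measurable_max0).
Qed.

Let measurable_B :
  measurable_fun setT (fun z : P * P * R => B z.1 (Num.max z.2 0)).
Proof. exact: measurable_morawetz measurable_disp measurable_vel. Qed.

Let measurable_H :
  measurable_fun setT (fun z : P * P * R => H z.1 (Num.max z.2 0)).
Proof. exact: measurable_morawetz_hess measurable_disp measurable_vel. Qed.

Let measurable_along1 g : phase_measurable g ->
  measurable_fun setT (fun z : P * P * R => along g z.1.1 (Num.max z.2 0)).
Proof.
move=> mg; have := measurable_fun_pair measurable_pair1
  (@measurable_snd _ _ (P * P)%type R).
by move=> /(measurableT_comp (measurable_along _ mg)).
Qed.

Let measurable_along2 g : phase_measurable g ->
  measurable_fun setT (fun z : P * P * R => along g z.1.2 (Num.max z.2 0)).
Proof.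
move=> mg; have := measurable_fun_pair measurable_pair2
  (@measurable_snd _ _ (P * P)%type R).
by move=> /(measurableT_comp (measurable_along _ mg)).
Qed.

(** At fixed [x] the kernel is [z . (xi - b) / rho]: the coefficients [z_i / rho] meet the momentum
    moments, and the constant term meets the mass moment. *)
Let morawetz_cancel (x a b : V) (t c : R) : 0 <= t ->
  (\int[leb]_xi (I f x xi t * (c * morawetz r (x - a) (xi - b)))%:E = 0)%E.
Proof.
move=> t0; have [m0 _ m1] := meso x t t0; have [i0 i1] := moment_integrable x t t0.
set z := x - a; set rho := smooth_norm r z.
pose h i xi : \bar R := ((c * z ord0 i / rho)%:E * (I f x xi t * xi ord0 i)%:E)%E.
have ih i : leb.-integrable setT (h i) by apply: integrableZl.
transitivity (\int[leb]_xi (\sum_(i < n) h i xi +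
    (- (c * dotp z b / rho))%:E * (I f x xi t)%:E))%E.
  apply: eq_integral => xi _; rewrite /h -EFinM.
  under eq_bigr do rewrite -EFinM.
  rewrite sumEFin -EFinD; congr EFin.
  rewrite /morawetz -/z -/rho -scaleN1r dotpDr dotpZr.
  rewrite mulrDl mulrDr mulrDr; congr (_ + _); last by ring.
  rewrite /dotp mulr_suml mulr_sumr mulr_sumr.
  by apply: eq_bigr => i _; ring.
rewrite integralD//; last 2 first.
- by apply: integrable_sum => // i _; exact: ih.
- exact: integrableZl.
rewrite integral_sum//.
rewrite integralZl// m0 mule0 adde0 big1// => i _.
by rewrite integralZl// m1 mule0.
Qed.

Let interaction_cancel_pair (y : P) (t : R) : 0 <= t ->
  (\int[phase]_p (Jw t p)%:E < +oo)%E ->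
  (\int[phase]_p (J p t * F y t * B (p, y) t)%:E = 0)%E.
Proof.
move=> t0 Joo.
(* The second particle is frozen at its current position [y.1 + t *: y.2], so [psi] is a function of
   the current position and velocity of the first; its growth constant is [F y t * weight y]. *)
pose psi (p : P) := F y t * morawetz r (p.1 - (y.1 + t *: y.2)) (p.2 - y.2).
have mpsi : measurable_fun setT psi.
  apply: measurable_funM => //.
  by apply: measurable_morawetz => //; apply: measurable_rVB.
rewrite -(interaction_cancel t psi (F y t * weight y) t0 Joo mpsi).
- apply: eq_integral => p _; rewrite /psi /B /disp /= -mulrA.
  by rewrite opprD addrACA scalerBr.
- move=> p; rewrite normrM ger0_norm ?F_ge0// -mulrA ler_wpM2l ?F_ge0// mulrC.
  exact: morawetz_le.
- by move=> x; exact: morawetz_cancel.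
Qed.

(** Exchanging the particles reverses both displacement and velocity. This reduces the term with [J]
    on the second particle to the one with [J] on the first. *)
Let B_sym (p q : P) t : B (p, q) t = B (q, p) t.
Proof.
rewrite /B /disp /= -morawetzNN; congr morawetz; last by rewrite opprB.
by rewrite opprD -scalerN !opprB.
Qed.

Let rate (q : P * P) (t : R) : R := J q.1 t * F q.2 t * B q t +
  F q.1 t * J q.2 t * B q t + F q.1 t * F q.2 t * H q t.

Let slice_time (h : P * P -> R -> R) t : 0 <= t ->
  measurable_fun setT (fun z : P * P * R => h z.1 (Num.max z.2 0)) ->
  measurable_fun setT (h ^~ t).
Proof.
move=> t0 mh; have := measurableT_comp mh (pair2_measurable t).
by congr measurable_fun; apply/funext => q /=; rewrite max_l.
Qed.

Let measurable_J12 : measurable_fun setT (fun z : P * P * R =>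
  J z.1.1 (Num.max z.2 0) * F z.1.2 (Num.max z.2 0) * B z.1 (Num.max z.2 0)).
Proof.
apply: measurable_funM measurable_B.
exact: (measurable_funM (measurable_along1 _ mI) (measurable_along2 _ mf)).
Qed.

Let measurable_J21 : measurable_fun setT (fun z : P * P * R =>
  F z.1.1 (Num.max z.2 0) * J z.1.2 (Num.max z.2 0) * B z.1 (Num.max z.2 0)).
Proof.
apply: measurable_funM measurable_B.
exact: (measurable_funM (measurable_along1 _ mf) (measurable_along2 _ mI)).
Qed.

Let measurable_FFH : measurable_fun setT (fun z : P * P * R =>
  F z.1.1 (Num.max z.2 0) * F z.1.2 (Num.max z.2 0) * H z.1 (Num.max z.2 0)).
Proof.
apply: measurable_funM measurable_H.
exact: (measurable_funM (measurable_along1 _ mf) (measurable_along2 _ mf)).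
Qed.

Let measurable_rate :
  measurable_fun setT (fun z : P * P * R => rate z.1 (Num.max z.2 0)).
Proof.
apply: (measurable_funD _ measurable_FFH).
exact: (measurable_funD measurable_J12 measurable_J21).
Qed.

Let J12_le q t : 0 <= t -> `|J q.1 t * F q.2 t * B q t| <= Jw t q.1 * Fw t q.2.
Proof.
move=> t0; rewrite 2!normrM (ger0_norm (F_ge0 q.2 t t0)) [leRHS]mulrACA.
by rewrite ler_wpM2l ?mulr_ge0 ?F_ge0.
Qed.

Let J21_le q t : 0 <= t -> `|F q.1 t * J q.2 t * B q t| <= Fw t q.1 * Jw t q.2.
Proof.
move=> t0; rewrite 2!normrM (ger0_norm (F_ge0 q.1 t t0)) [leRHS]mulrACA.
by rewrite ler_wpM2l ?mulr_ge0 ?F_ge0.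
Qed.

Let FFH_ge0 q t : 0 <= t -> 0 <= F q.1 t * F q.2 t * H q t.
Proof. by move=> t0; rewrite !mulr_ge0 ?F_ge0. Qed.

Let FFH_le q t : 0 <= t ->
  F q.1 t * F q.2 t * H q t <= 2 / r * (Fw t q.1 * Fw t q.2).
Proof.
move=> t0; have -> : 2 / r * (Fw t q.1 * Fw t q.2) =
    F q.1 t * F q.2 t * (2 / r * (weight q.1 * weight q.2)) by rewrite /Fw; ring.
by rewrite ler_wpM2l ?mulr_ge0 ?F_ge0.
Qed.

Let integral_FwFw t : 0 <= t ->
  (\int[pairs]_q (Fw t q.1 * Fw t q.2)%:E = ((M + E) ^+ 2)%:E)%E.
Proof.
move=> t0; rewrite ge0_integral_tensor//; last 4 first.
- exact: measurable_Fw.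
- exact: measurable_Fw.
- by move=> p; exact: Fw_ge0.
- by move=> p; exact: Fw_ge0.
by rewrite conservation// -EFinM expr2.
Qed.

Let integral_JwFw t : 0 <= t -> (\int[pairs]_q (Jw t q.1 * Fw t q.2)%:E =
  \int[phase]_p (Jw t p)%:E * (M + E)%:E)%E.
Proof.
move=> t0; rewrite ge0_integral_tensor//; last 3 first.
- exact: measurable_Jw.
- exact: measurable_Fw.
- by move=> p; exact: Fw_ge0.
by rewrite conservation.
Qed.

Let integral_FwJw t : 0 <= t -> (\int[pairs]_q (Fw t q.1 * Jw t q.2)%:E =
  \int[phase]_p (Jw t p)%:E * (M + E)%:E)%E.
Proof.
move=> t0; rewrite ge0_integral_tensor//; last 3 first.
- exact: measurable_Fw.
- exact: measurable_Jw.
- by move=> p; exact: Fw_ge0.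
by rewrite conservation// muleC.
Qed.

Let integral_Jw_ge0 t : (0 <= \int[phase]_p (Jw t p)%:E)%E.
Proof. by apply: integral_ge0 => p _; rewrite lee_fin. Qed.

Let J12_integrable t : 0 <= t -> (\int[phase]_p (Jw t p)%:E < +oo)%E ->
  pairs.-integrable setT (fun q => (J q.1 t * F q.2 t * B q t)%:E).
Proof.
move=> t0 Joo; apply: (dominated_integrable _ _ _ _ _ _ _ (fun q => J12_le q t t0)).
  exact: (slice_time (fun q t => J q.1 t * F q.2 t * B q t)).
by rewrite integral_JwFw// lte_mul_pinfty ?ltry ?ge0_fin_numE.
Qed.

Let J21_integrable t : 0 <= t -> (\int[phase]_p (Jw t p)%:E < +oo)%E ->
  pairs.-integrable setT (fun q => (F q.1 t * J q.2 t * B q t)%:E).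
Proof.
move=> t0 Joo; apply: (dominated_integrable _ _ _ _ _ _ _ (fun q => J21_le q t t0)).
  exact: (slice_time (fun q t => F q.1 t * J q.2 t * B q t)).
by rewrite integral_FwJw// lte_mul_pinfty ?ltry ?ge0_fin_numE.
Qed.

Let integral_FwFwZ t : 0 <= t ->
  (\int[pairs]_q (2 / r * (Fw t q.1 * Fw t q.2))%:E =
   (2 / r * (M + E) ^+ 2)%:E)%E.
Proof.
move=> t0; under eq_integral do rewrite EFinM.
rewrite ge0_integralZl_EFin//.
- by rewrite integral_FwFw.
- by move=> q _; rewrite lee_fin mulr_ge0// Fw_ge0.
- apply/measurable_EFinP; apply: measurable_funM.
    exact: (measurableT_comp (measurable_Fw t t0)).
  exact: (measurableT_comp (measurable_Fw t t0)).
- by rewrite divr_ge0// ltW.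
Qed.

Let FFH_integrable t : 0 <= t ->
  pairs.-integrable setT (fun q => (F q.1 t * F q.2 t * H q t)%:E).
Proof.
move=> t0; apply: (dominated_integrable _ _ _ _ _
    (fun q => 2 / r * (Fw t q.1 * Fw t q.2))).
- exact: (slice_time (fun q t => F q.1 t * F q.2 t * H q t)).
- by move=> q; rewrite ger0_norm ?FFH_ge0// FFH_le.
- by rewrite integral_FwFwZ// ltry.
Qed.

Let integral_rate t : 0 <= t -> (\int[phase]_p (Jw t p)%:E < +oo)%E ->
  (\int[pairs]_q (rate q t)%:E =
   \int[pairs]_q (F q.1 t * F q.2 t * H q t)%:E)%E.
Proof.
move=> t0 Joo; have [i12 i21] := (J12_integrable t t0 Joo, J21_integrable t t0 Joo).
have i3 := FFH_integrable t t0.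
transitivity (\int[pairs]_q ((J q.1 t * F q.2 t * B q t)%:E +
  (F q.1 t * J q.2 t * B q t)%:E + (F q.1 t * F q.2 t * H q t)%:E))%E.
  by apply: eq_integral => q _; rewrite -!EFinD.
rewrite integralD//; last exact: integrableD.
have z12 : (\int[pairs]_q (J q.1 t * F q.2 t * B q t)%:E = 0)%E.
  rewrite (fubini21 _ _ _ i12); apply: integral0_eq => y _.
  exact: interaction_cancel_pair.
have z21 : (\int[pairs]_q (F q.1 t * J q.2 t * B q t)%:E = 0)%E.
  rewrite (fubini12 _ _ _ i21); apply: integral0_eq => y _.
  rewrite -(interaction_cancel_pair y t t0 Joo); apply: eq_integral => p _ /=.
  by rewrite B_sym (mulrC (F y t)).
by rewrite integralD// z12 z21 !add0e.
Qed.

(** * The time-integrated Morawetz estimate *)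

Let hess_integral (t : R) : \bar R := (\int[pairs]_q
  (F q.1 (Num.max t 0) * F q.2 (Num.max t 0) * H q (Num.max t 0))%:E)%E.

Let measurable_hess_integral : measurable_fun setT hess_integral.
Proof.
apply: (measurable_integral1 pairs (fun z : P * P * R => (F z.1.1 (Num.max z.2 0) *
  F z.1.2 (Num.max z.2 0) * H z.1 (Num.max z.2 0))%:E)).
  exact/measurable_EFinP.
by move=> z; rewrite lee_fin FFH_ge0// le_max lexx orbT.
Qed.

Let hess_integral_ge0 t : (0 <= hess_integral t)%E.
Proof.
by apply: integral_ge0 => q _; rewrite lee_fin FFH_ge0// le_max lexx orbT.
Qed.

Let action (q : P * P) (t : R) : R := F q.1 t * F q.2 t * B q t.

Let measurable_action t : 0 <= t -> measurable_fun setT (action ^~ t).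
Proof.
move=> t0; apply: slice_time => //; apply: measurable_funM measurable_B.
exact: (measurable_funM (measurable_along1 _ mf) (measurable_along2 _ mf)).
Qed.

Let action_le q t : 0 <= t -> `|action q t| <= Fw t q.1 * Fw t q.2.
Proof.
move=> t0; rewrite 2!normrM (ger0_norm (F_ge0 q.1 t t0)).
rewrite (ger0_norm (F_ge0 q.2 t t0)) [leRHS]mulrACA.
by rewrite ler_wpM2l ?mulr_ge0 ?F_ge0.
Qed.

Let action_integrable t : 0 <= t ->
  pairs.-integrable setT (fun q => (action q t)%:E).
Proof.
move=> t0; apply: (dominated_integrable _ _ _ _ _ _ _ (fun q => action_le q t t0)).
  exact: measurable_action.
by rewrite integral_FwFw// ltry.
Qed.

Let action_integral_le t : 0 <= t ->
  (`| \int[pairs]_q (action q t)%:E | <= ((M + E) ^+ 2)%:E)%E.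
Proof.
move=> t0; apply: le_trans (le_abse_integral _ _ _) _ => //.
  exact: ((measurable_EFinP _ _).2 (measurable_action t t0)).
rewrite -(integral_FwFw t t0).
by apply: ge0_le_integral_nonmeasurable => q _; rewrite abse_EFin lee_fin// action_le.
Qed.

Let B_derive q (t : R) : is_derive t 1 (B q) (H q t).
Proof. exact: is_derive_morawetz. Qed.

Let action_derive (q : P * P) (t : R) : 0 < t -> is_derive t 1 (action q) (rate q t).
Proof.
move=> t0; apply: is_derive_eq (is_derive_fun_mul
  (is_derive_fun_mul (F_derive q.1 t t0) (F_derive q.2 t t0)) (B_derive q t)) _.
rewrite /rate; ring.
Qed.

Let K_ge0 : 0 <= M + E.
Proof.
rewrite -lee_fin -(conservation 0 (lexx 0)).
by apply: integral_ge0 => p _; rewrite lee_fin; exact: Fw_ge0.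
Qed.

(** Each of the two interaction terms costs [M + E] times the weighted integral of [|J|], and the
    Hessian term is bounded uniformly in time. The bound is thus integrable over bounded time
    intervals, which justifies exchanging time and phase integrals. *)
Let integral_rate_le t : 0 <= t -> (\int[pairs]_q `|rate q t|%:E <=
  \int[phase]_p (Jw t p)%:E * (2 * (M + E))%:E + (2 / r * (M + E) ^+ 2)%:E)%E.
Proof.
move=> t0.
have -> : (2 * (M + E))%:E = ((M + E)%:E + (M + E)%:E)%E :> \bar R.
  by rewrite -EFinD; congr EFin; ring.
rewrite ge0_muleDr ?lee_fin// -{1}(integral_JwFw t t0) -(integral_FwJw t t0).
rewrite -(integral_FwFwZ t t0).
have mT (g h : P -> R) : measurable_fun setT g -> measurable_fun setT h ->
    measurable_fun setT (fun q : P * P => (g q.1 * h q.2)%:E).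
  by move=> mg mh; apply/measurable_EFinP/measurable_funM; exact: measurableT_comp.
have [mFt mJt] := (measurable_Fw t t0, measurable_Jw t t0).
have mFF : measurable_fun setT (fun q : P * P => (2 / r * (Fw t q.1 * Fw t q.2))%:E).
  by under eq_fun do rewrite EFinM; apply: measurable_funeM; exact: mT.
have nJF q : (0 <= (Jw t q.1 * Fw t q.2)%:E)%E by rewrite lee_fin mulr_ge0// Fw_ge0.
have nFJ q : (0 <= (Fw t q.1 * Jw t q.2)%:E)%E by rewrite lee_fin mulr_ge0// Fw_ge0.
have nFF q : (0 <= (2 / r * (Fw t q.1 * Fw t q.2))%:E)%E.
  by rewrite lee_fin mulr_ge0 ?divr_ge0 ?(ltW r0)// mulr_ge0 ?Fw_ge0.
rewrite -(ge0_integralD _ measurableT (fun q _ => nJF q) (mT _ _ mJt mFt)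
  (fun q _ => nFJ q) (mT _ _ mFt mJt)).
rewrite -(ge0_integralD _ measurableT (fun q _ => adde_ge0 (nJF q) (nFJ q))
  (emeasurable_funD (mT _ _ mJt mFt) (mT _ _ mFt mJt)) (fun q _ => nFF q) mFF).
apply: ge0_le_integral_nonmeasurable => q _; first by rewrite lee_fin.
rewrite -!EFinD lee_fin (le_trans (ler_normD _ _))// lerD//.
  by rewrite (le_trans (ler_normD _ _))// lerD// ?J12_le// J21_le.
by rewrite ger0_norm ?FFH_ge0// FFH_le.
Qed.

Let measurable_Jw_integral :
  measurable_fun setT (fun t : R => \int[phase]_p (Jw (Num.max t 0) p)%:E)%E.
Proof.
apply: (measurable_integral1 phase (fun z : P * R => (Jw (Num.max z.2 0) z.1)%:E)).
  apply/measurable_EFinP/measurable_funM; first exact: measurableT_comp mJ.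
  exact: (measurableT_comp measurable_weight).
by move=> z; rewrite lee_fin.
Qed.

Let rate_lty T : 0 < T ->
  (\int[lam]_(t in `[0%R, T]) \int[pairs]_q `|rate q (Num.max t 0)|%:E < +oo)%E.
Proof.
move=> T0; pose C := 2 / r * (M + E) ^+ 2.
have C0 : 0 <= C by rewrite mulr_ge0 ?sqr_ge0// divr_ge0// ltW.
apply: (@le_lt_trans _ _ (\int[lam]_(t in `[0%R, T])
  ((\int[phase]_p (Jw (Num.max t 0) p)%:E) * (2 * (M + E))%:E + C%:E))%E).
  apply: ge0_le_integral_nonmeasurable => t.
    by move=> _; apply: integral_ge0 => q _.
  rewrite /= in_itv/= => /andP[t0 _]; rewrite max_l//.
  exact: integral_rate_le.
have mJT := measurable_funTS (D := `[0, T]%classic) measurable_Jw_integral.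
rewrite ge0_integralD//; last 2 first.
- by move=> t _; rewrite mule_ge0// lee_fin mulr_ge0.
- exact: emeasurable_funM.
apply: lte_add_pinfty; last first.
  by rewrite integral_cst//= lebesgue_measure_itv/= lte_fin T0 -EFinD ltry.
rewrite ge0_integralZr//; last by rewrite lee_fin mulr_ge0.
have int_ge0 : (0 <= \int[lam]_(t in `[0%R, T])
    \int[phase]_p (Jw (Num.max t 0) p)%:E)%E by exact: integral_ge0.
rewrite lte_mul_pinfty ?ltry ?ge0_fin_numE//.
apply: le_lt_trans (interaction_lty T T0).
apply: ge0_le_integral_nonmeasurable => // t.
by rewrite /= in_itv/= => /andP[t0 _]; rewrite max_l.
Qed.

(** The left-hand side is the increment of the action over [[0, T]], and each endpoint is at most
    [(M + E) ^+ 2] in absolute value; hence a bound uniform in [T]. *)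
Let morawetz_estimate T : 0 < T ->
  (\int[lam]_(t in `[0%R, T]) hess_integral t <= (2 * (M + E) ^+ 2)%:E)%E.
Proof.
move=> T0.
have : (\int[pairs]_q (action q T)%:E = \int[pairs]_q (action q 0)%:E +
    \int[lam]_(t in `[0%R, T]) hess_integral t)%E.
  apply: (@integral_derivative_in_time _ _ _ pairs action
    (fun z => rate z.1 (Num.max z.2 0)) hess_integral T T0).
  - move=> q s; apply: cvgM; first by apply: cvgM; exact: F_continuous.
    apply: continuous_subspaceT => t; have [dB _] := B_derive q t.
    exact/differentiable_continuous/derivable1_diffP.
  - move=> q t /andP[t0 _]; rewrite /= max_l ?(ltW t0)//; exact: action_derive.
  - exact: measurable_rate.
  - exact: (measurable_action T (ltW T0)).
  - exact: action_integrable.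
  - exact: rate_lty.
  - exact: measurable_funTS measurable_hess_integral.
  - apply: (@filterS _ _ (ae_filter_ringOfSetsType lam)) (interaction_ae T T0) => t Jt.
    move=> tT; have t0 : 0 <= t by move: tT; rewrite /= in_itv/= => /andP[].
    by rewrite /hess_integral /= max_l//; apply: integral_rate => //; exact: Jt.
have := action_integral_le 0 (lexx 0); have := action_integral_le T (ltW T0).
move: (\int[pairs]_q (action q T)%:E)%E (\int[pairs]_q (action q 0)%:E)%E
  (\int[lam]_(t in `[0%R, T]) hess_integral t)%E.
move=> [a||] [b||] [c||]//=; rewrite !lee_fin !ler_norml => /andP[_ aK] /andP[bK _] [e].
by lra.
Qed.
Let hess_integral_y :
  (\int[lam]_(t in `[0%R, +oo[) hess_integral t <= (2 * (M + E) ^+ 2)%:E)%E.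
Proof.
(* The upper end is [i + 1] because [morawetz_estimate] asks for a positive [T]; monotone
   convergence then gives the half-line. *)
pose A (i : nat) : set R := `[0, i.+1%:R]%classic.
have AU : \bigcup_i A i = `[0, +oo[%classic.
  apply/seteqP; split=> t /=; rewrite in_itv/= andbT.
    by move=> [i _]; rewrite /A /= in_itv/= => /andP[].
  move=> t0; exists (Num.truncn t) => //; rewrite /A /= in_itv/= t0/=.
  by have /andP[_ /ltW] := truncn_itv t0.
have Acvg : (\int[lam]_(t in A i) hess_integral t @[i --> \oo] -->
    \int[lam]_(t in \bigcup_i A i) hess_integral t)%E.
  apply: ge0_nondecreasing_set_cvg_integral => //.
  - move=> i j ij; apply/subsetPset => t; rewrite /A /= !in_itv/= => /andP[-> ti] /=.
    by rewrite (le_trans ti)// ler_nat ltnS.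
  - by move=> i; exact: measurable_itv.
  - by move=> i; exact: measurable_funTS measurable_hess_integral.
rewrite -AU -(cvg_lim _ Acvg)//.
apply: lime_le; first by apply/cvg_ex; eexists; exact: Acvg.
by apply: nearW => i; exact: morawetz_estimate.
Qed.

(** * Back to fixed coordinates and restriction to balls *)

Let hess_slice (t : R) (q : P * P) : R := f q.1.1 q.1.2 t * f q.2.1 q.2.2 t *
  morawetz_hess r (q.1.1 - q.2.1) (q.1.2 - q.2.2).

Let hess_slice_ge0 t q : 0 <= t -> 0 <= hess_slice t q.
Proof. by move=> t0; rewrite !mulr_ge0 ?f_ge0 ?morawetz_hess_ge0. Qed.

Let measurable_hess_slice t : 0 <= t -> measurable_fun setT (hess_slice t).
Proof.
move=> t0; have mft := measurable_slice _ _ mf t0.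
apply: measurable_funM; first by apply: measurable_funM; exact: (measurableT_comp mft).
apply: measurable_morawetz_hess => //; apply: measurable_rVB;
  by [apply: (measurableT_comp measurable_fst)
     |apply: (measurableT_comp measurable_snd)].
Qed.

(** Two shears, one per particle: first in the outer variable [y], then in [p] with [y] fixed. *)
Let integral_hess_slice t : 0 <= t ->
  (\int[phase]_y \int[phase]_p (hess_slice t (p, y))%:E = hess_integral t)%E.
Proof.
move=> t0.
have mh : measurable_fun setT (fun q => (hess_slice t q)%:E).
  exact: ((measurable_EFinP _ _).2 (measurable_hess_slice t t0)).
have h0 q : (0 <= (hess_slice t q)%:E)%E by rewrite lee_fin hess_slice_ge0.
rewrite -(integral_shear t); last exact: (measurable_integral1 phase _ mh h0).
rewrite /hess_integral (tonelli21 phase phase); last 2 first.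
- apply/measurable_EFinP.
  exact: (measurableT_comp measurable_FFH (pair2_measurable t)).
- by move=> q; rewrite lee_fin max_l// FFH_ge0.
apply: eq_integral => y _.
rewrite -(integral_shear t); last exact: (measurableT_comp mh (pair2_measurable _)).
apply: eq_integral => p _ /=; rewrite max_l// /hess_slice /= /H /disp /=.
by rewrite opprD addrACA -scalerBr.
Qed.

(** Inside the ball [sqnorm_le_morawetz_hess] compares the integrands; outside it the left side is
    replaced by 0 and the right side is nonnegative by convexity. *)
Let ball_integral_le t : 0 <= t ->
  (\int[leb]_x0 \int[leb]_xi0 \int[leb]_(x in eball x0 r) \int[leb]_xi
    (f x xi t * f x0 xi0 t * sqnorm (xi - xi0))%:E <=
   (4 * r)%:E * hess_integral t)%E.
Proof.
move=> t0; rewrite -integral_hess_slice//.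
have mh : measurable_fun setT (fun q => (hess_slice t q)%:E).
  exact: ((measurable_EFinP _ _).2 (measurable_hess_slice t t0)).
have h0 q : (0 <= (hess_slice t q)%:E)%E by rewrite lee_fin hess_slice_ge0.
have mI1 := measurable_integral1 phase _ mh h0.
have r4 : 0 <= 4 * r by rewrite mulr_ge0// ltW.
have g0 x xi x0 xi0 : 0 <= f x xi t * f x0 xi0 t * sqnorm (xi - xi0).
  by rewrite !mulr_ge0 ?sqnorm_ge0 ?f_ge0.
rewrite -ge0_integralZl_EFin//; last by move=> y _; exact: integral_ge0.
rewrite (tonelli12 leb leb); last 2 first.
- exact: measurable_funeM.
- by move=> y; rewrite mule_ge0// integral_ge0.
apply: ge0_le_integral_nonmeasurable => x0 _.
  by do 3! (apply: integral_ge0 => ? _); rewrite lee_fin.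
apply: ge0_le_integral_nonmeasurable => xi0 _.
  by do 2! (apply: integral_ge0 => ? _); rewrite lee_fin.
rewrite -ge0_integralZl_EFin//; last exact: (measurableT_comp mh (pair2_measurable _)).
rewrite (tonelli12 leb leb); last 2 first.
- exact: measurable_funeM (measurableT_comp mh (pair2_measurable _)).
- by move=> p; rewrite mule_ge0.
rewrite integral_mkcond; apply: ge0_le_integral_nonmeasurable => x _; rewrite patchE.
  by case: ifPn => // _; apply: integral_ge0 => xi _; rewrite lee_fin.
case: ifPn => [/set_mem xB|_]; last first.
  by apply: integral_ge0 => xi _; rewrite mule_ge0.
apply: ge0_le_integral_nonmeasurable => xi _; first by rewrite lee_fin.
rewrite -EFinM lee_fin /hess_slice /= mulrCA ler_wpM2l ?mulr_ge0 ?f_ge0//.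
exact: sqnorm_le_morawetz_hess.
Qed.

(** The factor [4 * r] lost on the ball cancels [r^-1], leaving 4 times the bound [2 * (M + E) ^+ 2]
    on the increment of the action. *)
Lemma morawetz_interaction_le : ((r^-1)%:E *
  \int[lam]_(t in `[0%R, +oo[) \int[leb]_x0 \int[leb]_xi0
  \int[leb]_(x in eball x0 r) \int[leb]_xi
    (f x xi t * f x0 xi0 t * sqnorm (xi - xi0))%:E
  <= (8 * (M + E) ^+ 2)%:E)%E.
Proof.
have r4 : 0 <= 4 * r by rewrite mulr_ge0// ltW.
apply: (@le_trans _ _ ((r^-1)%:E *
    \int[lam]_(t in `[0%R, +oo[) ((4 * r)%:E * hess_integral t))%E).
  apply: lee_pmul => //.
  - by rewrite lee_fin invr_ge0 ltW.
  - apply: integral_ge0 => t; rewrite /= in_itv/= andbT => t0.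
    do 4! (apply: integral_ge0 => ? _).
    by rewrite lee_fin !mulr_ge0 ?sqnorm_ge0 ?f_ge0.
  apply: ge0_le_integral_nonmeasurable => t; rewrite /= in_itv/= andbT => t0.
    do 4! (apply: integral_ge0 => ? _).
    by rewrite lee_fin !mulr_ge0 ?sqnorm_ge0 ?f_ge0.
  exact: ball_integral_le.
rewrite ge0_integralZl_EFin//; last exact: measurable_funTS measurable_hess_integral.
rewrite muleA -EFinM mulrCA mulVf ?lt0r_neq0// mulr1.
apply: (@le_trans _ _ (4%:E * (2 * (M + E) ^+ 2)%:E)%E).
  by apply: lee_pmul => //; exact: integral_ge0.
by rewrite -EFinM lee_fin; lra.
Qed.

End kinetic_estimates.

Theorem theorem2p1 (R : realType) (n : nat) :
  exists W : R -> R -> R,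
  forall (I : ('rV[R]_n -> 'rV[R]_n -> R -> R) -> 'rV[R]_n -> 'rV[R]_n -> R -> R)
         (f : 'rV[R]_n -> 'rV[R]_n -> R -> R) (f0 : 'rV[R]_n -> 'rV[R]_n -> R)
         (M E : R),
    (forall x xi t, 0 <= t -> 0 <= f x xi t) ->
    transport_solution I f f0 ->
    mesoscopic I f ->
    integrable_interaction I f ->
    total_mass (fun x xi => f x xi 0) = M%:E ->
    total_energy (fun x xi => f x xi 0) = E%:E ->
    forall r : R, 0 < r ->
      ((r^-1)%:E *
       \int[lebesgue_measure]_(t in `[0%R, +oo[)
       \int[lebesgue_rV n]_x0 \int[lebesgue_rV n]_xi0
       \int[lebesgue_rV n]_(x in eball x0 r) \int[lebesgue_rV n]_xi
         (f x xi t * f x0 xi0 t * sqnorm (xi - xi0))%:E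
       < (W M E)%:E)%E.
Proof.
(* The summand 1 turns the bound into a strict inequality, also when [M + E = 0]. *)
exists (fun M E => 8 * (M + E) ^+ 2 + 1).
move=> I f f0 M E f_ge0 sol meso intI mass energy r r0.
have := morawetz_interaction_le I f f0 M E f_ge0 sol meso intI mass energy r r0.
by move=> /le_lt_trans; apply; rewrite lte_fin ltrDl.
Qed.
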